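(* Let $1<p<\infty$. Suppose that $B$ is a $(k,a)$-Fourier multiplier whose symbol $h$ satisfies $$\sup_{s>0}\, s\left[\int_{\{\xi\in\mathbb{R}^N:\ |h(\xi)|\ge s\}}d\mu_{k,a}(\xi)\right]^{\frac12-\frac1{2p}}<\infty .$$ Then, for $u_0\in L^2_{k,a}(\mathbb{R}^N)$, the Cauchy problem $$u_t-|Bu(t)|^p=0,\qquad u(0)=u_0,$$ has a local solution in the space $L^\infty(0,T^*;L^2_{k,a}(\mathbb{R}^N))$ for some $T^*>0$; that is, there exist $T^*>0$ and $u\in L^\infty(0,T^*;L^2_{k,a}(\mathbb{R}^N))$ with $$u(t)=u_0+\int_0^t|Bu(\tau)|^p\,d\tau$$ in $L^\infty(0,T^*;L^2_{k,a}(\mathbb{R}^N))$.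
   Context: Setting. $N\ge1$; $\mathcal{R}\subset\mathbb{R}^N\setminus\{0\}$ is a (reduced) root system with positive subsystem $\mathcal{R}_+$; $r_\alpha$ is the orthogonal reflection in the hyperplane $\alpha^\perp$; $\mathfrak{G}\subset O(N,\mathbb{R})$ is the reflection group generated by the $r_\alpha$, $\alpha\in\mathcal{R}$; $k:\mathcal{R}\to[0,\infty)$, $\alpha\mapsto k_\alpha$, is a $\mathfrak{G}$-invariant function (multiplicity function); $a>0$. $\langle\cdot,\cdot\rangle$ and $\|\cdot\|$ are the Euclidean inner product and norm. Put $\langle k\rangle=\frac12\sum_{\alpha\in\mathcal{R}}k_\alpha$, $v_k(x)=\prod_{\alpha\in\mathcal{R}}|\langle\alpha,x\rangle|^{k_\alpha}$, $v_{k,a}(x)=\|x\|^{a-2}v_k(x)$, $d\mu_{k,a}(x)=v_{k,a}(x)\,dx$, and $L^p_{k,a}(\mathbb{R}^N)=L^p(\mathbb{R}^N,\mu_{k,a})$. Dunkl Laplacian. For $\xi\in\mathbb{R}^N$, $T_\xi(k)f(x)=\partial_\xi f(x)+\sum_{\alpha\in\mathcal{R}_+}k_\alpha\langle\alpha,\xi\rangle\frac{f(x)-f(r_\alpha x)}{\langle\alpha,x\rangle}$, and $\Delta_k=\sum_{j=1}^N T_{\xi_j}(k)^2$ for any orthonormal basis $\xi_1,\dots,\xi_N$ of $\mathbb{R}^N$. $(k,a)$-generalised Fourier transform. Let $\Delta_{k,a}=\|x\|^{2-a}\Delta_k-\|x\|^a$ and assume $a+2\langle k\rangle+N-2>0$.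 Then $$\mathcal{F}_{k,a}=\exp\left[\frac{i\pi}{2}\cdot\frac{2\langle k\rangle+N+a-2}{a}\right]\exp\left[\frac{i\pi}{2a}\Delta_{k,a}\right],$$ a unitary operator on $L^2_{k,a}(\mathbb{R}^N)$. Here the exponential is that of the self-adjoint realisation of $\Delta_{k,a}$ diagonalised by the functions $\Phi(x)=p(x)\,L_\ell^{(\lambda_m)}\!\left(\tfrac2a\|x\|^a\right)e^{-\|x\|^a/a}$, where $\ell,m\in\mathbb{N}_0$, $p$ is a homogeneous polynomial of degree $m$ with $\Delta_kp=0$, $\lambda_m=(2m+2\langle k\rangle+N-2)/a$, and $L_\ell^{(\lambda)}$ are the Laguerre polynomials; these functions span a dense subspace of $L^2_{k,a}(\mathbb{R}^N)$ and $\mathcal{F}_{k,a}\Phi=e^{-i\pi(\ell+m/a)}\Phi$. One has $\mathcal{F}_{k,a}f(\xi)=c_{k,a}\int_{\mathbb{R}^N}B_{k,a}(\xi,x)f(x)\,d\mu_{k,a}(x)$ with a normalising constant $c_{k,a}$ and a symmetric distribution kernel $B_{k,a}$ (not to be confused with the operator $B$). Standing assumption. $N\ge1$, $k\ge0$, $a>0$, $a+2\langle k\rangle+N-2>0$, and $B_{k,a}$ is uniformly bounded: $|B_{k,a}(\xi,x)|\le M<\infty$ for all $x,\xi\in\mathbb{R}^N$. (It is known that this boundedness holds if, in addition to $a+2\langle k\rangle+N-2>0$, one of the following holds: $N=1$ and $a>0$; $a=1$ and $2\langle k\rangle+N-2\ge0$; $a=2$; $k=0$ and $a=2/m$ for some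 $m\in\mathbb{N}$.) Under it $\mathcal{F}_{k,a}$ and its inverse $\mathcal{F}_{k,a}^{-1}$ (the inverse on $L^2_{k,a}$, which also has a uniformly bounded kernel) extend to $L^1_{k,a}(\mathbb{R}^N)+L^2_{k,a}(\mathbb{R}^N)$. Fourier multipliers. A linear operator $B$ defined on $L^2_{k,a}(\mathbb{R}^N)$ is a $(k,a)$-Fourier multiplier with symbol $h$, $h:\mathbb{R}^N\to\mathbb{C}$ measurable, if $\mathcal{F}_{k,a}(Bf)(\xi)=h(\xi)\mathcal{F}_{k,a}f(\xi)$ for a.e. $\xi$, i.e. $Bf=\mathcal{F}_{k,a}^{-1}(h\,\mathcal{F}_{k,a}f)$ with $h\,\mathcal{F}_{k,a}f\in L^1_{k,a}+L^2_{k,a}$. The operator $B$ acts in the space variable $x$ for each fixed time. *)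

(* Defs.v *)
From HB Require Import structures.
From mathcomp Require Import all_boot all_order all_algebra.
From mathcomp Require Import finmap complex.
From mathcomp Require Import all_classical all_reals all_analysis.
From mathcomp Require Import measurable_realfun.
From mathcomp Require mpoly.

Set Implicit Arguments.
Unset Strict Implicit.
Unset Printing Implicit Defensive.
Import Order.TTheory GRing.Theory Num.Theory.
Import numFieldNormedType.Exports.
Local Open Scope classical_set_scope.
Local Open Scope ring_scope.
Local Open Scope complex_scope.

(* 'rV[R]_n carries the sigma-algebra generated by the coordinates, which is
   the Borel sigma-algebra of R^n. *)
Section borel_rV.
Variables (R : realType) (n : nat).

Let coords (i : 'I_n) : 'rV[R]_n -> R := fun x => x ord0 i.

Let rV_set0 : g_sigma_preimage coords set0.
Proof. exact: sigma_algebra0. Qed.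

Let rV_setC A : g_sigma_preimage coords A -> g_sigma_preimage coords (~` A).
Proof. exact: sigma_algebraC. Qed.

Let rV_bigcup (F : (set 'rV[R]_n)^nat) :
  (forall i, g_sigma_preimage coords (F i)) ->
  g_sigma_preimage coords (\bigcup_i (F i)).
Proof. exact: sigma_algebra_bigcup. Qed.

HB.instance Definition _ :=
  @isMeasurable.Build (measure_tuple_display default_measure_display)
    'rV[R]_n (g_sigma_preimage coords) rV_set0 rV_setC rV_bigcup.

Lemma measurable_rV_coord (i : 'I_n) :
  measurable_fun [set: 'rV[R]_n] (fun x => x ord0 i).
Proof.
move=> _ Y mY; rewrite setTI; apply: sub_sigma_algebra => /=.
rewrite -bigcup_seq/=; exists i => /=; first by rewrite mem_index_enum.
by exists Y => //; rewrite setTI.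
Qed.

Lemma measurable_fun_rVP d (T : measurableType d) (f : T -> 'rV[R]_n) :
  measurable_fun [set: T] f <->
  forall i, measurable_fun [set: T] (fun x => f x ord0 i).
Proof.
split=> [mf i|mf].
  exact: (measurableT_comp (measurable_rV_coord i) mf).
move=> _ A mA; rewrite setTI.
pose G : set (set 'rV[R]_n) := [set B | measurable (f @^-1` B)].
suff: g_sigma_preimage coords `<=` G by exact.
apply: smallest_sub.
  split=> [|B mB|F mF].
  - by rewrite /G /= preimage_set0; exact: measurable0.
  - by rewrite /G /= setTD preimage_setC; exact: measurableC.
  - by rewrite /G /= preimage_bigcup; exact: bigcupT_measurable.
move=> B; rewrite -bigcup_seq => -[i _ [Y mY <-]].
rewrite /G /= setTI -comp_preimage -[X in measurable X]setTI.
exact: mf.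
Qed.

End borel_rV.

Section lebesgue_rV.
Variable R : realType.

Definition rV_cons n (p : measurableTypeR R * 'rV[R]_n) : 'rV[R]_n.+1 :=
  \row_i (if unlift ord0 i is Some j then p.2 ord0 j else p.1).

Definition rV_uncons n (v : 'rV[R]_n.+1) : measurableTypeR R * 'rV[R]_n :=
  (v ord0 ord0, \row_i v ord0 (lift ord0 i)).

Lemma rV_consK n : cancel (@rV_cons n) (@rV_uncons n).
Proof.
move=> [x v]; congr (_, _); first by rewrite mxE unlift_none.
by apply/rowP => i; rewrite !mxE liftK.
Qed.

Lemma measurable_rV_cons n : measurable_fun setT (@rV_cons n).
Proof.
apply/measurable_fun_rVP => i.
under eq_fun do rewrite mxE.
case: unliftP => [j _|_]; last exact: measurable_fst.
exact: (measurableT_comp (measurable_rV_coord j) measurable_snd).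
Qed.

Lemma measurable_rV_uncons n : measurable_fun setT (@rV_uncons n).
Proof.
apply/measurable_fun_pairP; split; first exact: (measurable_rV_coord ord0).
apply/measurable_fun_rVP => i /=.
under eq_fun do rewrite mxE.
exact: measurable_rV_coord.
Qed.

Section step.
Variables (n : nat) (m : {sigma_finite_measure set 'rV[R]_n -> \bar R}).

Definition lebesgue_rV_step : set 'rV[R]_n.+1 -> \bar R :=
  pushforward (@lebesgue_measure R \x m)%E (@rV_cons n).

Let step0 : lebesgue_rV_step set0 = 0%E.
Proof. by rewrite /lebesgue_rV_step /pushforward preimage_set0 measure0. Qed.

Let step_ge0 A : (0 <= lebesgue_rV_step A)%E.
Proof. exact: (@measure_ge0 _ _ _ (lebesgue_measure \x m)%E). Qed.

Let step_sigma_additive : semi_sigma_additive lebesgue_rV_step.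
Proof.
exact: (@measure_semi_sigma_additive _ _ _
  (measure_function_pushforward__canonical__measure_function_Measure
     (@lebesgue_measure R \x m)%E (@measurable_rV_cons n))).
Qed.

HB.instance Definition _ := isMeasure.Build _ _ _
  lebesgue_rV_step step0 step_ge0 step_sigma_additive.

Let step_sigma_finite : sigma_finite setT lebesgue_rV_step.
Proof.
have /sigma_finiteP[F [UF ndF mF]] := sigma_finiteT (@lebesgue_measure R).
have /sigma_finiteP[G [UG ndG mG]] := sigma_finiteT m.
exists (fun k => @rV_uncons n @^-1` (F k `*` G k)).
  rewrite -preimage_bigcup; apply/esym/seteqP; split=> // v _ /=.
  have [i _ Fi] : (\bigcup_i F i) (rV_uncons v).1 by rewrite -UF.
  have [j _ Gj] : (\bigcup_j G j) (rV_uncons v).2 by rewrite -UG.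
  exists (maxn i j) => //; split.
  - by move: Fi; exact/subsetPset/ndF/leq_maxl.
  - by move: Gj; exact/subsetPset/ndG/leq_maxr.
move=> k; have [mFk Foo] := mF k; have [mGk Goo] := mG k; split.
  rewrite -[X in measurable X]setTI; apply: measurable_rV_uncons => //.
  exact: measurableX.
rewrite /lebesgue_rV_step /pushforward -comp_preimage.
rewrite (_ : _ \o _ = id) ?preimage_id; last first.
  by apply/funext => p /=; rewrite rV_consK.
by rewrite product_measure1E// lte_mul_pinfty// ge0_fin_numE.
Qed.

HB.instance Definition _ := Measure_isSigmaFinite.Build _ _ _
  lebesgue_rV_step step_sigma_finite.
End step.

Fixpoint lebesgue_rV n : {sigma_finite_measure set 'rV[R]_n -> \bar R} :=
  match n with
  | 0%N => dirac (0 : 'rV[R]_0)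
  | n'.+1 => lebesgue_rV_step (lebesgue_rV n')
  end.
End lebesgue_rV.

Section dunkl.
Variables (R : realType) (N : nat).
Local Notation Rn := 'rV[R]_N.
Implicit Types (Rt Rp : {fset Rn}) (k : Rn -> R) (a : R) (x y xi alpha : Rn).

Definition dot x y : R := \sum_(i < N) x ord0 i * y ord0 i.

(* The library norm of 'rV is the sup norm; this is the Euclidean one. *)
Definition enorm x : R := Num.sqrt (dot x x).

Definition refl alpha x : Rn := x - (2 * dot alpha x / dot alpha alpha) *: alpha.

Definition root_system Rt : Prop :=
  [/\ 0 \notin Rt,
      (forall alpha beta, alpha \in Rt -> beta \in Rt -> refl alpha beta \in Rt)
    & (forall alpha (c : R), alpha \in Rt -> c *: alpha \in Rt ->
         c = 1 \/ c = -1)].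

Definition positive_subsystem Rt Rp : Prop :=
  exists beta : Rn, (forall alpha, alpha \in Rt -> dot alpha beta != 0) /\
    (forall alpha, (alpha \in Rp) = (alpha \in Rt) && (0 < dot alpha beta)).

(* The reflections are involutions, so words in them already form a group. *)
Inductive reflection_group Rt : (Rn -> Rn) -> Prop :=
| reflection_group1 : reflection_group Rt id
| reflection_groupM alpha g : alpha \in Rt -> reflection_group Rt g ->
    reflection_group Rt (refl alpha \o g).

Definition multiplicity Rt k : Prop :=
  (forall alpha, alpha \in Rt -> 0 <= k alpha) /\
  (forall g alpha, reflection_group Rt g -> alpha \in Rt ->
     k (g alpha) = k alpha).

Definition kindex Rt k : R := 2^-1 * \sum_(alpha <- Rt) k alpha.

Definition weight Rt k a x : R :=
  enorm x `^ (a - 2) * \prod_(alpha <- Rt) `|dot alpha x| `^ k alpha.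

Lemma measurable_dot alpha : measurable_fun setT (dot alpha).
Proof.
apply: measurable_sum => i; apply: measurable_funM => //.
exact: measurable_rV_coord.
Qed.

Lemma measurable_enorm : measurable_fun setT enorm.
Proof.
apply: (@measurableT_comp _ _ _ _ _ _ (@Num.sqrt R)).
  by apply: continuous_measurable_fun; exact: sqrt_continuous.
by apply: measurable_sum => i; apply: measurable_funM; exact: measurable_rV_coord.
Qed.

Lemma measurable_weight Rt k a : measurable_fun setT (weight Rt k a).
Proof.
apply: measurable_funM.
  exact: (measurableT_comp (measurable_powR _) measurable_enorm).
apply: measurable_prod => alpha _.
apply: (measurableT_comp (measurable_powR _)).
exact: (measurableT_comp (@normr_measurable R setT) (measurable_dot alpha)).
Qed.

Lemma weight_ge0 Rt k a x : 0 <= weight Rt k a x.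
Proof.
by apply: mulr_ge0; [exact: powR_ge0|apply: prodr_ge0 => ? _; exact: powR_ge0].
Qed.

Section ka_measure.
Variables (Rt : {fset Rn}) (k : Rn -> R) (a : R).

Definition ka_measure (A : set Rn) : \bar R :=
  (\int[lebesgue_rV R N]_(x in A) (weight Rt k a x)%:E)%E.

Let ka_measure0 : ka_measure set0 = 0%E.
Proof. exact: integral_set0. Qed.

Let ka_measure_ge0 A : (0 <= ka_measure A)%E.
Proof. by apply: integral_ge0 => x _; rewrite lee_fin weight_ge0. Qed.

Let ka_measure_sigma_additive : semi_sigma_additive ka_measure.
Proof.
move=> F mF tF mUF; rewrite /ka_measure ge0_integral_bigcup//=.
- apply: is_cvg_ereal_nneg_natsum => n _.
  by apply: integral_ge0 => x _; rewrite lee_fin weight_ge0.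
- by apply/measurable_EFinP; apply: measurable_funTS; exact: measurable_weight.
- by move=> x _; rewrite lee_fin weight_ge0.
Qed.

HB.instance Definition _ := isMeasure.Build _ _ _
  ka_measure ka_measure0 ka_measure_ge0 ka_measure_sigma_additive.
End ka_measure.

(* On the hyperplane orthogonal to alpha the difference quotient is replaced by
   its limit: there f x - f (refl alpha x) is, to first order,
   (2 <alpha,x> / |alpha|^2) times the derivative of f along alpha. *)
Definition dunkl_quotient alpha (f : Rn -> R) x : R :=
  if dot alpha x == 0 then 2 / dot alpha alpha * 'D_alpha f x
  else (f x - f (refl alpha x)) / dot alpha x.

Definition dunkl_op Rp k xi (f : Rn -> R) x : R :=
  'D_xi f x +
  \sum_(alpha <- Rp) k alpha * dot alpha xi * dunkl_quotient alpha f x.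

Definition dunkl_laplacian Rp k (f : Rn -> R) x : R :=
  \sum_(j < N) dunkl_op Rp k (delta_mx ord0 j)
                 (dunkl_op Rp k (delta_mx ord0 j) f) x.

Definition ka_laplacian Rp k a (f : Rn -> R) x : R :=
  enorm x `^ (2 - a) * dunkl_laplacian Rp k f x - enorm x `^ a * f x.

End dunkl.

(* Sum over j <= l of (-1)^j binomial(l + lam, l - j) t^j / j!, with the
   generalised binomial coefficient written as a product. *)
Definition laguerre (R : realType) (l : nat) (lam t : R) : R :=
  \sum_(j < l.+1) (-1) ^+ j * (\prod_(j.+1 <= i < l.+1) (lam + i%:R))
    / ((l - j)`!)%:R * t ^+ j / (j`!)%:R.

Section eigenfunctions.
Variables (R : realType) (N : nat).
Local Notation Rn := 'rV[R]_N.

Definition poly_fun m (p : mpoly.dhomog N R m) (x : Rn) : R :=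
  mpoly.meval (fun i => x ord0 i) (mpoly.mpoly_of_dhomog p).

Definition ka_eigenfunction (Rt : {fset Rn}) (k : Rn -> R) (a : R)
    (l m : nat) (p : mpoly.dhomog N R m) (x : Rn) : R :=
  let lam := (2 * m%:R + 2 * kindex Rt k + N%:R - 2) / a in
  poly_fun p x * laguerre l lam (2 / a * enorm x `^ a)
    * expR (- (enorm x `^ a / a)).
End eigenfunctions.

Section complex_Lp.
Context d (T : measurableType d) (R : realType).
Variable mu : {measure set T -> \bar R}.
Implicit Types f g : T -> R[i].

Definition cmeasurable f : Prop :=
  measurable_fun setT (fun x => complex.Re (f x)) /\
  measurable_fun setT (fun x => complex.Im (f x)).

Definition cnorm (p : \bar R) f : \bar R :=
  Lnorm mu p (fun x => (Normc.normc (f x))%:E).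

Definition inLp (p : \bar R) f : Prop := cmeasurable f /\ (cnorm p f < +oo)%E.

Definition cintegral f : R[i] :=
  (\int[mu]_x complex.Re (f x)) +i* (\int[mu]_x complex.Im (f x)).

(* Operators on L^2 act on functions and are considered up to equality almost
   everywhere. *)
Definition linear_on_L2 (U : (T -> R[i]) -> (T -> R[i])) : Prop :=
  forall (c : R[i]) f g, inLp 2%:E f -> inLp 2%:E g ->
    U (fun x => c * f x + g x) = (fun x => c * U f x + U g x) %[ae mu].

Definition unitary_on_L2 (U : (T -> R[i]) -> (T -> R[i])) : Prop :=
  [/\ forall f, inLp 2%:E f -> inLp 2%:E (U f),
      linear_on_L2 U,
      forall f, inLp 2%:E f -> cnorm 2%:E (U f) = cnorm 2%:E f
    & forall g, inLp 2%:E g -> exists2 f, inLp 2%:E f & U f = g %[ae mu]].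
End complex_Lp.

Definition cis (R : realType) (t : R) : R[i] := cos t +i* sin t.

Section ka_transform.
Variables (R : realType) (N : nat).
Local Notation Rn := 'rV[R]_N.
Variables (Rt Rp : {fset Rn}) (k : Rn -> R) (a : R).
Local Notation mu := (ka_measure Rt k a).
Local Notation L1 := (inLp mu 1%:E).
Local Notation L2 := (inLp mu 2%:E).
Implicit Types (F B : (Rn -> R[i]) -> (Rn -> R[i])) (f g w h : Rn -> R[i])
  (K : Rn -> Rn -> R[i]).

(* E = exp(i theta D), D being the self-adjoint realisation of ka_laplacian
   diagonalised by the functions ka_eigenfunction: on an eigenfunction with
   eigenvalue ev, E acts as multiplication by e^(i theta ev).  These functions
   span a dense subspace, so E is determined.  It suffices to take p real, as E
   is complex linear and the Dunkl Laplacian has real coefficients. *)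
Definition exp_i_ka_laplacian (theta : R) E : Prop :=
  unitary_on_L2 mu E /\
  forall (l m : nat) (p : mpoly.dhomog N R m) (ev : R),
    (forall x, dunkl_laplacian Rp k (poly_fun p) x = 0) ->
    let Phi := ka_eigenfunction Rt k a l p in
    ka_laplacian Rp k a Phi = (fun x => ev * Phi x) %[ae mu] ->
    E (fun x => (Phi x)%:C) = (fun x => cis (theta * ev) * (Phi x)%:C) %[ae mu].

Definition ka_fourier F : Prop :=
  exists2 E, exp_i_ka_laplacian (pi / (2 * a)) E &
    forall f, L2 f -> F f =
      (fun x => cis (pi / 2 * ((2 * kindex Rt k + N%:R + a - 2) / a)) * E f x)
      %[ae mu].

Definition bounded_ka_kernel F (c : R[i]) K : Prop :=
  [/\ cmeasurable (fun z : Rn * Rn => K z.1 z.2),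
      forall xi x, K xi x = K x xi,
      exists M : R, forall xi x, Normc.normc (K xi x) <= M
    & forall f, L1 f -> L2 f ->
        F f = (fun xi => c * cintegral mu (fun x => K xi x * f x)) %[ae mu]].

(* w is the image of g in L^1 + L^2 under the extension of the inverse of F.
   As F is unitary, its inverse is its adjoint, whose kernel is the conjugate
   transpose of that of F; this kernel is applied to the L^1 part of g. *)
Definition ka_fourier_inv F (c : R[i]) K g w : Prop :=
  exists g1 g2 v,
    [/\ L1 g1, L2 g2, g = (fun xi => g1 xi + g2 xi) %[ae mu],
        L2 v /\ F v = g2 %[ae mu]
      & w = (fun x => c^* * cintegral mu (fun xi => (K xi x)^* * g1 xi) + v x)
          %[ae mu]].

Definition ka_multiplier F (c : R[i]) K B h : Prop :=
  [/\ cmeasurable h, linear_on_L2 mu B,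
      forall f, L2 f -> cmeasurable (B f)
    & forall f, L2 f -> ka_fourier_inv F c K (fun xi => h xi * F f xi) (B f)].

Definition weak_symbol_norm (p : R) h : \bar R :=
  let lvl (s : R) := [set xi : Rn | s <= Normc.normc (h xi)] in
  ereal_sup [set (s%:E * mu (lvl s) `^ (1 / 2 - 1 / (2 * p))%R)%E
            | s in [set s : R | 0 < s]].
End ka_transform.

(* Bochner measurability and integration, in L^2(mu), of functions of time. *)
Section bochner.
Context d (T : measurableType d) (R : realType).
Variable mu : {measure set T -> \bar R}.
Local Notation L2 := (inLp mu 2%:E).
Local Notation leb := (@lebesgue_measure R).
Implicit Types (D : set R) (v u : R -> T -> R[i]).

Record L2simple := MkL2simple {
  simple_size : nat;
  simple_set : 'I_simple_size -> set R;
  simple_val : 'I_simple_size -> T -> R[i];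
  simple_measurable : forall j, measurable (simple_set j);
  simple_L2 : forall j, L2 (simple_val j) }.

Definition simple_fun (s : L2simple) (t : R) (x : T) : R[i] :=
  \sum_(j < simple_size s) (\1_(simple_set j) t)%:C * simple_val j x.

(* Used for D of finite Lebesgue measure only. *)
Definition simple_integral D (s : L2simple) (x : T) : R[i] :=
  \sum_(j < simple_size s)
    (fine (leb (simple_set j `&` D)))%:C * simple_val j x.

Definition L2dist (f g : T -> R[i]) : \bar R :=
  cnorm mu 2%:E (fun x => f x - g x).

Definition simple_approx D v (s : nat -> L2simple) : Prop :=
  {ae leb, forall t, D t ->
    L2dist (simple_fun (s n) t) (v t) @[n --> \oo] --> 0%E}.

Definition strongly_measurable D v : Prop :=
  {ae leb, forall t, D t -> L2 (v t)} /\ exists s, simple_approx D v s.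

Definition bochner_integral D v w : Prop :=
  [/\ strongly_measurable D v, L2 w
    & exists s, [/\ simple_approx D v s,
        (\int[leb]_(t in D) L2dist (simple_fun (s n) t) (v t))%E
          @[n --> \oo] --> 0%E
      & L2dist (simple_integral D (s n)) w @[n --> \oo] --> 0%E]].

Definition Linfty_L2 (Ts : R) u : Prop :=
  strongly_measurable `]0, Ts[ u /\
  exists M : R, {ae leb, forall t, `]0, Ts[%classic t ->
    (cnorm mu 2%:E (u t) <= M%:E)%E}.

Definition mild_solution (B : (T -> R[i]) -> (T -> R[i])) (p : R)
    (u0 : T -> R[i]) (Ts : R) u : Prop :=
  {ae leb, forall t, `]0, Ts[%classic t ->
    exists2 w,
      bochner_integral `]0, t[ (fun tau x => (Normc.normc (B (u tau) x) `^ p)%:C) w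
    & u t = (fun x => u0 x + w x) %[ae mu]}.
End bochner.

(* Main.v *)
(* The multiplier B maps L^2 boundedly to L^(2p), by a direct real
   interpolation argument. Unitarity of F and Fubini identify the inverse of
   F on the intersection of L^1 and L^2 with the integral against the
   conjugate kernel, so B f may be computed from any splitting of h F f.
   Write g = F f with ||g|| <= 1 and r = 2p/(p-1), so that h is in weak L^r.
   For lambda > 0 put s = kappa / lambda^(p-1). The part of h g where |h| > s
   is integrable, and since the kernel is bounded its inverse image is at
   most lambda/2 everywhere for a suitable kappa; the part where |h| <= s is
   in L^2, with inverse image u_lambda. Hence |B f| >= lambda forces
   |u_lambda| >= |B f|/2, and summing over lambda = 2^j,
     int |B f|^(2p) <= C sum_j 2^(2j(p-1)) int_{|h| <= s_j} |h g|^2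
                    <= C' int |g|^2,
   because at each point the sum over j is geometric. So f |-> |B f|^p maps
   L^2 into itself and is Lipschitz on balls, and the Cauchy problem is
   solved by the dyadic Euler schemes: they converge at the rate 2^-n, and
   the Euler polygon at time t is the integral of a step function of time,
   which gives the Bochner integral without further measurability arguments. *)
From HB Require Import structures.
Require Import Defs.
From mathcomp Require Import all_boot all_order all_algebra.
From mathcomp Require Import finmap complex.
From mathcomp Require Import all_classical all_reals all_analysis.
From mathcomp Require Import measurable_realfun ring lra.
Set Implicit Arguments.
Unset Strict Implicit.
Unset Printing Implicit Defensive.
Import Order.TTheory GRing.Theory Num.Theory.
Import numFieldNormedType.Exports.
Local Open Scope classical_set_scope.
Local Open Scope ring_scope.
Local Open Scope complex_scope.

(** The cut [kappa / lambda^(p-1)] is forced by the exponent r, for which 1/r = 1/2 - 1/(2p). For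
    ||g|| <= 1, Cauchy-Schwarz bounds the L^1 norm of the part of h g where |h| > s by the square
    root of the integral of |h|^2 over that set. This root is of order s^((2-r)/2) = s^(-1/(p-1)),
    and it is of order lambda exactly when s is of order lambda^(-(p-1)). The tail integral is
    finite because r > 2. The obstacle is the meaning of B f. The hypothesis on B yields, for each
    f, some splitting of h F f into an L^1 and an L^2 part, whereas the argument needs a different
    prescribed splitting at every height lambda. Two splittings differ by a function of both L^1 and
    L^2, so it must be shown that the L^2 inverse and the integral against the conjugate kernel
    agree there. *)

Local Notation normc := Normc.normc.

(** * Complex-valued functions and the L2 seminorm *)

Section complex_numbers.
Context {R : rcfType}.
Implicit Types z w : R[i].

Lemma complexReM z w : complex.Re (z * w) =
  complex.Re z * complex.Re w - complex.Im z * complex.Im w.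
Proof. by case: z => a b; case: w => c d. Qed.

Lemma complexImM z w : complex.Im (z * w) =
  complex.Re z * complex.Im w + complex.Im z * complex.Re w.
Proof. by case: z => a b; case: w => c d. Qed.

Lemma complexReD z w : complex.Re (z + w) = complex.Re z + complex.Re w.
Proof. by case: z => a b; case: w => c d. Qed.

Lemma complexImD z w : complex.Im (z + w) = complex.Im z + complex.Im w.
Proof. by case: z => a b; case: w => c d. Qed.

Lemma complexReN z : complex.Re (- z) = - complex.Re z.
Proof. by case: z. Qed.

Lemma complexImN z : complex.Im (- z) = - complex.Im z.
Proof. by case: z. Qed.

Lemma complexReJ z : complex.Re z^* = complex.Re z.
Proof. by case: z. Qed.

Lemma complexImJ z : complex.Im z^* = - complex.Im z.
Proof. by case: z. Qed.

Lemma normc_sqr z :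
  normc z ^+ 2 = complex.Re z ^+ 2 + complex.Im z ^+ 2.
Proof. by case: z => a b /=; rewrite sqr_sqrtr// addr_ge0 ?sqr_ge0. Qed.

Lemma normc_ge0 z : 0 <= normc z.
Proof. by case: z => a b; exact: sqrtr_ge0. Qed.

Lemma normcD z w : normc (z + w) <= normc z + normc w.
Proof. exact: le_normcD. Qed.

Lemma normc_opp z : normc (- z) = normc z.
Proof. by case: z => a b /=; rewrite !sqrrN. Qed.

Lemma normc_conj z : normc z^* = normc z.
Proof. by case: z => a b /=; rewrite !sqrrN. Qed.

Lemma normc_subC z w : normc (z - w) = normc (w - z).
Proof. by rewrite -normc_opp opprB. Qed.

Lemma normc_real (r : R) : normc r%:C = `|r|.
Proof. by rewrite /= expr0n addr0 sqrtr_sqr. Qed.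

Lemma ler_dist_normc z w : `|normc z - normc w| <= normc (z - w).
Proof.
rewrite ler_norml; apply/andP; split.
  by rewrite normc_subC lerNl opprB lerBlDr (le_trans _ (normcD _ _))// subrK.
by rewrite lerBlDr (le_trans _ (normcD _ _))// subrK.
Qed.

Lemma Re_le_normc z : `|complex.Re z| <= normc z.
Proof.
rewrite -(@ler_pXn2r _ 2) ?nnegrE ?normc_ge0//.
by rewrite real_normK ?num_real// normc_sqr lerDl sqr_ge0.
Qed.

Lemma Im_le_normc z : `|complex.Im z| <= normc z.
Proof.
rewrite -(@ler_pXn2r _ 2) ?nnegrE ?normc_ge0//.
by rewrite real_normK ?num_real// normc_sqr lerDr sqr_ge0.
Qed.

End complex_numbers.

Section cmeasurable.
Context d (T : measurableType d) (R : realType).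
Implicit Types f g : T -> R[i].

Lemma cmeasurable_cst (z : R[i]) : cmeasurable (fun _ : T => z).
Proof. by split; exact: measurable_cst. Qed.

Lemma cmeasurableD f g : cmeasurable f -> cmeasurable g ->
  cmeasurable (fun x => f x + g x).
Proof.
move=> [fr fi] [gr gi]; split.
- by under eq_fun do rewrite complexReD; exact: measurable_funD.
- by under eq_fun do rewrite complexImD; exact: measurable_funD.
Qed.

Lemma cmeasurableM f g : cmeasurable f -> cmeasurable g ->
  cmeasurable (fun x => f x * g x).
Proof.
move=> [fr fi] [gr gi]; split.
- by under eq_fun do rewrite complexReM;
    apply: measurable_funB; exact: measurable_funM.
- by under eq_fun do rewrite complexImM;
    apply: measurable_funD; exact: measurable_funM.
Qed.

Lemma cmeasurableN f : cmeasurable f -> cmeasurable (fun x => - f x).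
Proof.
move=> mf; under eq_fun do rewrite -mulN1r.
by apply: cmeasurableM => //; exact: cmeasurable_cst.
Qed.

Lemma cmeasurableB f g : cmeasurable f -> cmeasurable g ->
  cmeasurable (fun x => f x - g x).
Proof. by move=> mf /cmeasurableN; exact: cmeasurableD. Qed.

Lemma cmeasurable_conj f : cmeasurable f -> cmeasurable (fun x => (f x)^*).
Proof.
move=> [fr fi]; split; first by under eq_fun do rewrite complexReJ.
by under eq_fun do rewrite complexImJ; exact: measurableT_comp.
Qed.

Lemma cmeasurable_real (g : T -> R) : measurable_fun setT g ->
  cmeasurable (fun x => (g x)%:C).
Proof. by move=> mg; split. Qed.

Lemma cmeasurable_comp d' (T' : measurableType d') (g : T' -> T) f :
  cmeasurable f -> measurable_fun setT g -> cmeasurable (fun x => f (g x)).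
Proof.
move=> [fr fi] mg; split.
- exact: (measurableT_comp fr mg).
- exact: (measurableT_comp fi mg).
Qed.

Lemma measurable_normc f : cmeasurable f ->
  measurable_fun setT (fun x => normc (f x)).
Proof.
move=> [fr fi].
rewrite (_ : (fun _ => _) =
  Num.sqrt \o (fun x => complex.Re (f x) ^+ 2 + complex.Im (f x) ^+ 2)).
  apply: measurableT_comp.
    by apply: continuous_measurable_fun; exact: sqrt_continuous.
  by apply: measurable_funD; exact: measurable_funX.
by apply/funext => x /=; case: (f x).
Qed.

End cmeasurable.

Section L2.
Context d (T : measurableType d) (R : realType).
Variable mu : {measure set T -> \bar R}.
Implicit Types f g : T -> R[i].
Local Notation L1 := (inLp mu 1%:E).
Local Notation L2 := (inLp mu 2%:E).

(** The squared seminorm as an extended-real integral: linearity and monotonicity of integration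
    apply to it directly, and [cnorm2_le] converts the result. *)
Definition energy f : \bar R := (\int[mu]_x (normc (f x) ^+ 2)%:E)%E.

Lemma energy_ge0 f : (0 <= energy f)%E.
Proof. by apply: integral_ge0 => x _; rewrite lee_fin sqr_ge0. Qed.

Lemma measurable_normc_sqr f : cmeasurable f ->
  measurable_fun setT (fun x => (normc (f x) ^+ 2)%:E).
Proof.
by move=> mf; apply/measurable_EFinP/measurable_funX/measurable_normc.
Qed.

Lemma cnorm2_sqr f : (cnorm mu 2%:E f `^ 2 = energy f)%E.
Proof.
rewrite /cnorm poweR_Lnorm; last by rewrite pnatr_eq0.
apply: eq_integral => x _ /=.
by rewrite powR_mulrn ?normr_ge0// ger0_norm// normc_ge0.
Qed.

Lemma cnorm_ge0 p f : (0 <= cnorm mu p f)%E.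
Proof. exact: Lnorm_ge0. Qed.

Lemma cnorm2_le f (r : R) : 0 <= r ->
  (cnorm mu 2%:E f <= r%:E)%E = (energy f <= (r ^+ 2)%:E)%E.
Proof.
move=> r0; rewrite -cnorm2_sqr.
have := cnorm_ge0 2%:E f; case: (cnorm mu 2%:E f) => [s|_|] //=.
- rewrite !lee_fin => s0; rewrite powR_mulrn//.
  by rewrite ler_pXn2r ?nnegrE.
- by rewrite pnatr_eq0 /=.
Qed.

Lemma inL2P f : L2 f <-> cmeasurable f /\ (energy f < +oo)%E.
Proof.
suff H : (cnorm mu 2%:E f < +oo <-> energy f < +oo)%E.
  by split=> -[mf] /H.
rewrite -cnorm2_sqr.
have := cnorm_ge0 2%:E f; case: (cnorm mu 2%:E f) => [s|_|] //=.
- by move=> _; rewrite !ltry.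
- by rewrite pnatr_eq0.
Qed.

Lemma inL1P f : L1 f <->
  cmeasurable f /\ (\int[mu]_x (normc (f x))%:E < +oo)%E.
Proof.
rewrite /inLp /cnorm Lnorm1.
by under eq_integral => x _ do rewrite /= ger0_norm ?normc_ge0//.
Qed.

Lemma energy_le_ae f g : cmeasurable f -> cmeasurable g ->
  {ae mu, forall x, normc (f x) <= normc (g x)} -> (energy f <= energy g)%E.
Proof.
move=> mf mg fg; apply: ae_ge0_le_integral => //.
- by move=> x _; rewrite lee_fin sqr_ge0.
- exact: measurable_normc_sqr.
- by move=> x _; rewrite lee_fin sqr_ge0.
- exact: measurable_normc_sqr.
- apply: filterS fg => x fg _.
  by rewrite lee_fin ler_pXn2r ?nnegrE ?normc_ge0.
Qed.

Lemma cnorm2_le_ae f g : cmeasurable f -> cmeasurable g ->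
  {ae mu, forall x, normc (f x) <= normc (g x)} ->
  (cnorm mu 2%:E f <= cnorm mu 2%:E g)%E.
Proof.
move=> mf mg /(energy_le_ae mf mg); rewrite -(cnorm2_sqr g).
have := cnorm_ge0 2%:E g; case: (cnorm mu 2%:E g) => [s|_|] //=.
- rewrite lee_fin => s0; rewrite powR_mulrn// => h.
  by rewrite cnorm2_le.
- by rewrite leey.
Qed.

Lemma cnorm2_ae_eq f g : cmeasurable f -> cmeasurable g ->
  f = g %[ae mu] -> cnorm mu 2%:E f = cnorm mu 2%:E g.
Proof.
move=> mf mg fg; apply/eqP; rewrite eq_le; apply/andP; split.
  by apply: cnorm2_le_ae => //; apply: filterS fg => x /(_ I) ->.
by apply: cnorm2_le_ae => //; apply: filterS fg => x /(_ I) ->.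
Qed.

Lemma cnorm2D f g : cmeasurable f -> cmeasurable g ->
  (cnorm mu 2%:E (fun x => f x + g x)%R <=
   cnorm mu 2%:E f + cnorm mu 2%:E g)%E.
Proof.
move=> mf mg.
have mfn := measurable_normc mf; have mgn := measurable_normc mg.
apply: le_trans (minkowski_EFin mu mfn mgn _); last by rewrite ler1n.
(* Minkowski is applied to the moduli; [w] is their sum as a complex function, with which
   [cnorm2_le_ae] compares [f + g]. *)
pose w x := (normc (f x) + normc (g x))%:C.
have mw : cmeasurable w by apply/cmeasurable_real/measurable_funD.
have nw x : normc (w x) = normc (f x) + normc (g x).
  by rewrite normc_real ger0_norm// addr_ge0 ?normc_ge0.
rewrite [leRHS](_ : _ = cnorm mu 2%:E w).
  apply: cnorm2_le_ae => //; first exact: cmeasurableD.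
  by apply: aeW => x; rewrite nw normcD.
by rewrite /cnorm; congr Lnorm; apply/funext => x; rewrite nw.
Qed.

Lemma cnormN p f : cnorm mu p (fun x => - f x) = cnorm mu p f.
Proof. by apply: eq_Lnorm => x; rewrite normc_opp. Qed.

Lemma cnorm2B f g : cmeasurable f -> cmeasurable g ->
  (cnorm mu 2%:E (fun x => f x - g x)%R <=
   cnorm mu 2%:E f + cnorm mu 2%:E g)%E.
Proof. by move=> mf mg; rewrite -(cnormN _ g) cnorm2D//; exact: cmeasurableN. Qed.

Lemma energyZ (z : R[i]) f : cmeasurable f ->
  energy (fun x => z * f x) = ((normc z ^+ 2)%:E * energy f)%E.
Proof.
move=> mf; rewrite /energy -ge0_integralZl//=; last 3 first.
- exact: measurable_normc_sqr.
- by move=> x _; rewrite lee_fin sqr_ge0.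
- by rewrite lee_fin sqr_ge0.
by apply: eq_integral => x _; rewrite Normc.normcM exprMn EFinM.
Qed.

Lemma cnorm2Z (z : R[i]) f (r : R) : cmeasurable f -> 0 <= r ->
  (cnorm mu 2%:E f <= r%:E)%E ->
  (cnorm mu 2%:E (fun x => z * f x)%R <= (normc z * r)%:E)%E.
Proof.
move=> mf r0; rewrite !cnorm2_le ?mulr_ge0 ?normc_ge0// energyZ// => h.
by rewrite exprMn [leRHS]EFinM lee_pmul// ?energy_ge0// lee_fin sqr_ge0.
Qed.

Lemma cnorm2_0 : cnorm mu 2%:E (fun=> 0) = 0%E.
Proof.
apply/eqP; rewrite eq_le cnorm_ge0 andbT cnorm2_le// expr0n /energy.
by rewrite integral0_eq// => x _; rewrite Normc.normc0 expr0n.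
Qed.

Lemma L2_fin f : L2 f -> exists2 r : R, 0 <= r & cnorm mu 2%:E f = r%:E.
Proof.
move=> [_]; have := cnorm_ge0 2%:E f.
by case: (cnorm mu 2%:E f) => // r; rewrite lee_fin => r0 _; exists r.
Qed.

Lemma L2_le f (r : R) : cmeasurable f -> (cnorm mu 2%:E f <= r%:E)%E -> L2 f.
Proof. by move=> mf h; split=> //; apply: le_lt_trans h _; rewrite ltry. Qed.

Lemma L2D f g : L2 f -> L2 g -> L2 (fun x => f x + g x).
Proof.
move=> [mf fo] [mg go]; split; first exact: cmeasurableD.
by apply: le_lt_trans (cnorm2D mf mg) _; rewrite lte_add_pinfty.
Qed.

Lemma L2Z (z : R[i]) f : L2 f -> L2 (fun x => z * f x).
Proof.
move=> Lf; have [r r0 fr] := L2_fin Lf; have [mf _] := Lf.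
apply: (@L2_le _ (normc z * r)).
  by apply: cmeasurableM => //; exact: cmeasurable_cst.
by apply: cnorm2Z => //; rewrite fr.
Qed.

Lemma L2N f : L2 f -> L2 (fun x => - f x).
Proof. by move=> [mf fo]; split; [exact: cmeasurableN|rewrite cnormN]. Qed.

Lemma L2B f g : L2 f -> L2 g -> L2 (fun x => f x - g x).
Proof. by move=> Lf /L2N; exact: L2D. Qed.

Lemma L2_0 : L2 (fun=> 0).
Proof. by split; [exact: cmeasurable_cst|rewrite cnorm2_0]. Qed.

Lemma energy_eq0 f : cmeasurable f -> energy f = 0%E -> f = (fun=> 0) %[ae mu].
Proof.
move=> mf f0.
have /(ae_eq_integral_abs mu measurableT (measurable_normc_sqr mf)) :
    (\int[mu]_x `|(normc (f x) ^+ 2)%:E| = 0)%E.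
  by rewrite -f0; apply: eq_integral => x _; rewrite gee0_abs// lee_fin sqr_ge0.
apply: filterS => x /(_ I) [] /eqP.
by rewrite expf_eq0 /= => /eqP /Normc.eq0_normc.
Qed.

Lemma energy_fine f : L2 f -> (energy f \is a fin_num)%E.
Proof. by move=> /inL2P[_ fo]; rewrite ge0_fin_numE// energy_ge0. Qed.

End L2.

(** * The kernel of the inverse transform *)

Section cintegral.
Context d (T : measurableType d) (R : realType).
Variable mu : {measure set T -> \bar R}.
Implicit Types f g : T -> R[i].
Local Notation L1 := (inLp mu 1%:E).
Local Notation L2 := (inLp mu 2%:E).

Lemma integrable_le_normc (M : R) g (w : T -> R) : L1 g ->
  measurable_fun setT w -> (forall x, `|w x| <= M * normc (g x)) ->
  mu.-integrable setT (EFin \o w).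
Proof.
move=> /inL1P[mg go] mw wg.
have ig : mu.-integrable setT (fun x => (normc (g x))%:E).
  apply/integrableP; split; first exact/measurable_EFinP/measurable_normc.
  by under eq_integral do rewrite gee0_abs ?lee_fin ?normc_ge0//.
apply: (le_integrable measurableT _ _ (integrableZl measurableT M ig)).
  exact/measurable_EFinP.
move=> x _ /=; rewrite lee_fin.
exact: le_trans (wg x) (ler_norm _).
Qed.

Lemma integrable_Re f : L1 f ->
  mu.-integrable setT (EFin \o (fun x => complex.Re (f x))).
Proof.
move=> Lf; have [[mr _] _] := Lf.
by apply: (integrable_le_normc (M := 1) Lf) => // x; rewrite mul1r Re_le_normc.
Qed.

Lemma integrable_Im f : L1 f ->
  mu.-integrable setT (EFin \o (fun x => complex.Im (f x))).
Proof.
move=> Lf; have [[_ mi] _] := Lf.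
by apply: (integrable_le_normc (M := 1) Lf) => // x; rewrite mul1r Im_le_normc.
Qed.

Lemma L1_normc_le (M : R) f g : L1 g -> cmeasurable f ->
  (forall x, normc (f x) <= M * normc (g x)) -> L1 f.
Proof.
move=> Lg mf fg; apply/inL1P; split=> //.
have /integrableP[_] :
    mu.-integrable setT (EFin \o (fun x => normc (f x))).
  apply: (integrable_le_normc Lg (measurable_normc mf)) => x.
  by rewrite ger0_norm ?normc_ge0.
by under eq_integral do rewrite /= ger0_norm ?normc_ge0//.
Qed.

Lemma L1D f g : L1 f -> L1 g -> L1 (fun x => f x + g x).
Proof.
move=> /inL1P[mf fo] /inL1P[mg go]; apply/inL1P; split.
  exact: cmeasurableD.
have mfn := measurable_normc mf; have mgn := measurable_normc mg.
apply: (@le_lt_trans _ _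
    (\int[mu]_x ((normc (f x))%:E + (normc (g x))%:E))%E); last first.
  rewrite ge0_integralD//; [exact: lte_add_pinfty|..].
  - by move=> x _; rewrite lee_fin normc_ge0.
  - exact/measurable_EFinP.
  - by move=> x _; rewrite lee_fin normc_ge0.
  - exact/measurable_EFinP.
apply: ge0_le_integral => //.
- by move=> x _; rewrite lee_fin normc_ge0.
- exact/measurable_EFinP/measurable_normc/cmeasurableD.
- by apply: emeasurable_funD; exact/measurable_EFinP.
- by move=> x _; rewrite -EFinD lee_fin normcD.
Qed.

Lemma L1N f : L1 f -> L1 (fun x => - f x).
Proof.
move=> Lf; apply: (@L1_normc_le 1 _ f) => //.
  by apply: cmeasurableN; case: Lf.
by move=> x; rewrite mul1r normc_opp.
Qed.

Lemma L1B f g : L1 f -> L1 g -> L1 (fun x => f x - g x).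
Proof. by move=> Lf /L1N; exact: L1D. Qed.

Lemma cintegralB f g : L1 f -> L1 g ->
  cintegral mu (fun x => f x - g x) = cintegral mu f - cintegral mu g.
Proof.
move=> Lf Lg; rewrite /cintegral.
under eq_Rintegral do rewrite complexReD complexReN.
rewrite RintegralB//; [|exact: integrable_Re..].
under [X in _ +i* X]eq_Rintegral do rewrite complexImD complexImN.
by rewrite RintegralB//; exact: integrable_Im.
Qed.

Lemma Re_mul_cintegral (z : R[i]) f : L1 f ->
  complex.Re (z * cintegral mu f) = \int[mu]_x complex.Re (z * f x).
Proof.
move=> Lf; have iR := integrable_Re Lf; have iI := integrable_Im Lf.
rewrite complexReM /= -RintegralZl// -RintegralZl// -RintegralB//.
- by apply: eq_Rintegral => x _; rewrite complexReM.
- exact: (integrableZl measurableT _ iR).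
- exact: (integrableZl measurableT _ iI).
Qed.

(** Rotation by the conjugate of the value [w] of the integral: [normc w ^+ 2] is the integral of
    the real part of [w^* * f], hence at most [normc w] times the integral of [normc f]. *)
Lemma normc_cintegral f : L1 f ->
  normc (cintegral mu f) <= \int[mu]_x normc (f x).
Proof.
move=> Lf; set w := cintegral mu f.
have [->|w0] := eqVneq (normc w) 0.
  by apply: Rintegral_ge0 => x _; exact: normc_ge0.
have wp : 0 < normc w by rewrite lt_neqAle eq_sym w0 normc_ge0.
have mf : cmeasurable f by case: Lf.
have inf : mu.-integrable setT (EFin \o (fun x => normc (f x))).
  apply: (integrable_le_normc (M := 1) Lf); first exact: measurable_normc.
  by move=> x; rewrite mul1r ger0_norm ?normc_ge0.
rewrite -(ler_pM2l wp) -RintegralZl//.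
have -> : normc w * normc w = complex.Re (w^* * w).
  by rewrite complexReM complexReJ complexImJ mulNr opprK -!expr2 -normc_sqr.
rewrite Re_mul_cintegral//; apply: le_Rintegral => //.
- apply: (integrable_le_normc (M := normc w) Lf).
    by case: (cmeasurableM (cmeasurable_cst T w^*) mf).
  by move=> x; apply: le_trans (Re_le_normc _) _; rewrite Normc.normcM normc_conj.
- exact: (integrableZl measurableT _ inf).
- move=> x _; apply: le_trans (ler_norm _) _.
  by apply: le_trans (Re_le_normc _) _; rewrite Normc.normcM normc_conj.
Qed.

Lemma normcM_le (z w : R[i]) : normc z * normc w <= normc z ^+ 2 + normc w ^+ 2.
Proof. by have := normc_ge0 z; have := normc_ge0 w; nra. Qed.

(** Only integrability of the product is wanted, so a pointwise bound by the sum of the squares does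
    the work of Cauchy-Schwarz. *)
Lemma L2M f g : L2 f -> L2 g -> L1 (fun x => f x * g x).
Proof.
move=> /inL2P[mf fo] /inL2P[mg go]; apply/inL1P.
have mfg := cmeasurableM mf mg; split=> //.
apply: (@le_lt_trans _ _
    (\int[mu]_x ((normc (f x) ^+ 2)%:E + (normc (g x) ^+ 2)%:E))%E); last first.
  rewrite ge0_integralD//; [exact: lte_add_pinfty|..].
  - by move=> x _; rewrite lee_fin sqr_ge0.
  - exact: measurable_normc_sqr.
  - by move=> x _; rewrite lee_fin sqr_ge0.
  - exact: measurable_normc_sqr.
apply: ge0_le_integral => //.
- by move=> x _; rewrite lee_fin normc_ge0.
- exact/measurable_EFinP/measurable_normc.
- by apply: emeasurable_funD; exact: measurable_normc_sqr.
- by move=> x _; rewrite Normc.normcM -EFinD lee_fin normcM_le.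
Qed.

(** The real part of the Hermitian product. It is what the expansion of the energy of a sum
    contains, and it suffices for [inverse_kernel], where a function is paired with its own
    truncation. *)
Definition cdot f g : R := \int[mu]_x complex.Re (f x * (g x)^*).

Lemma L2_conj f : L2 f -> L2 (fun x => (f x)^*).
Proof.
move=> [mf fo]; split; first exact: cmeasurable_conj.
rewrite (_ : cnorm _ _ _ = cnorm mu 2%:E f)//.
by apply: eq_Lnorm => x; rewrite normc_conj.
Qed.

Lemma integrable_cdot f g : L2 f -> L2 g ->
  mu.-integrable setT (EFin \o (fun x => complex.Re (f x * (g x)^*))).
Proof. by move=> Lf Lg; apply: integrable_Re; apply: L2M => //; exact: L2_conj. Qed.

Lemma integrable_sqr f : L2 f ->
  mu.-integrable setT (EFin \o (fun x => normc (f x) ^+ 2)).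
Proof.
move=> /inL2P[mf fo]; apply/integrableP; split; first exact: measurable_normc_sqr.
by under eq_integral do rewrite gee0_abs ?lee_fin ?sqr_ge0//.
Qed.

Lemma energyD f g : L2 f -> L2 g -> fine (energy mu (fun x => f x + g x)) =
  fine (energy mu f) + 2 * cdot f g + fine (energy mu g).
Proof.
move=> Lf Lg.
have i1 := integrable_sqr Lf; have i2 := integrable_sqr Lg.
have i3 := integrableZl measurableT 2 (integrable_cdot Lf Lg).
rewrite -RintegralZl//; last exact: integrable_cdot.
rewrite -!/(Rintegral _ _ _) -RintegralD// -RintegralD//; last first.
  exact: (integrableD measurableT i1 i3).
apply: eq_Rintegral => x _.
rewrite !normc_sqr complexReM complexReJ complexImJ complexReD complexImD; ring.
Qed.

End cintegral.

(** * The inverse of a unitary transform as integration against the conjugate kernel *)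

Section inverse_kernel.
Context d (T : measurableType d) (R : realType).
Variable mu : {sigma_finite_measure set T -> \bar R}.
Implicit Types f g : T -> R[i].
Local Notation L1 := (inLp mu 1%:E).
Local Notation L2 := (inLp mu 2%:E).

(** No integrability is assumed: the integrals of the positive and negative parts are measurable in
    [y] by Tonelli, and [fine] is measurable, its value 0 at the infinities included. *)
Lemma measurable_integral_fst (h : T * T -> R) : measurable_fun setT h ->
  measurable_fun setT (fun y => \int[mu]_x h (x, y)).
Proof.
move=> mh; rewrite /Rintegral.
apply: (measurableT_comp (fine_measurable _)) => //.
under eq_fun do rewrite integralE.
apply: emeasurable_funB.
- rewrite (_ : (fun _ => _) = fubini_G mu (EFin \o h)^\+%E); last first.
    by apply/funext => y; apply: eq_integral => x _; rewrite !funeposE.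
  apply: measurable_fun_fubini_tonelli_G => //.
  exact/measurable_funepos/measurable_EFinP.
- rewrite (_ : (fun _ => _) = fubini_G mu (EFin \o h)^\-%E); last first.
    by apply/funext => y; apply: eq_integral => x _; rewrite !funenegE.
  apply: measurable_fun_fubini_tonelli_G => //.
  exact/measurable_funeneg/measurable_EFinP.
Qed.

Lemma cmeasurable_cintegral_fst (h : T * T -> R[i]) : cmeasurable h ->
  cmeasurable (fun y => cintegral mu (fun x => h (x, y))).
Proof.
move=> [hr hi]; split.
- exact: (measurable_integral_fst hr).
- exact: (measurable_integral_fst hi).
Qed.

Variables (K : T -> T -> R[i]) (M : R) (c : R[i]).
Hypothesis mK : cmeasurable (fun z : T * T => K z.1 z.2).
Hypothesis KM : forall x y, normc (K x y) <= M.

Lemma cmeasurable_kernel_l x : cmeasurable (fun y => K x y).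
Proof.
apply: (cmeasurable_comp (f := fun z : T * T => K z.1 z.2)
  (g := fun y => (x, y))) => //.
exact: measurable_pair1.
Qed.

Lemma cmeasurable_kernel_r y : cmeasurable (fun x => K x y).
Proof.
apply: (cmeasurable_comp (f := fun z : T * T => K z.1 z.2)
  (g := fun x => (x, y))) => //.
Qed.

Lemma L1_kernel_l x f : L1 f -> L1 (fun y => K x y * f y).
Proof.
move=> Lf; have [mf _] := Lf.
apply: (L1_normc_le (M := M) Lf).
  by apply: cmeasurableM => //; exact: cmeasurable_kernel_l.
by move=> y; rewrite Normc.normcM ler_wpM2r ?normc_ge0.
Qed.

(** The adjoint of the kernel operator of [F], up to the factor [c^*]: the integration runs over the
    first variable of [K]. *)
Definition conj_transform f x := cintegral mu (fun xi => (K xi x)^* * f xi).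

Lemma L1_kernel_r y f : L1 f -> L1 (fun x => (K x y)^* * f x).
Proof.
move=> Lf; have [mf _] := Lf.
apply: (L1_normc_le (M := M) Lf).
  by apply: cmeasurableM => //; apply/cmeasurable_conj/cmeasurable_kernel_r.
by move=> x; rewrite Normc.normcM normc_conj ler_wpM2r ?normc_ge0.
Qed.

Lemma cmeasurable_conj_transform f : cmeasurable f ->
  cmeasurable (conj_transform f).
Proof.
move=> mf.
have mH : cmeasurable (fun z : T * T => (K z.1 z.2)^* * f z.1).
  apply: cmeasurableM; first exact: cmeasurable_conj.
  exact: (cmeasurable_comp mf measurable_fst).
exact: (cmeasurable_cintegral_fst mH).
Qed.

Lemma normc_conj_transform f x : L1 f ->
  normc (conj_transform f x) <= M * \int[mu]_xi normc (f xi).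
Proof.
move=> Lf; apply: le_trans (normc_cintegral (L1_kernel_r x Lf)) _.
have inf : mu.-integrable setT (EFin \o (fun x => normc (f x))).
  apply: (integrable_le_normc (M := 1) Lf).
    by apply: measurable_normc; case: Lf.
  by move=> y; rewrite mul1r ger0_norm ?normc_ge0.
rewrite -RintegralZl//; apply: le_Rintegral => //.
- have Lk := L1_kernel_r x Lf.
  apply: (integrable_le_normc (M := 1) Lk).
    by apply: measurable_normc; case: Lk.
  by move=> y; rewrite mul1r ger0_norm ?normc_ge0.
- exact: (integrableZl measurableT _ inf).
- by move=> y _; rewrite Normc.normcM normc_conj ler_wpM2r ?normc_ge0.
Qed.

Lemma conj_transformB f g x : L1 f -> L1 g ->
  conj_transform (fun xi => f xi - g xi) x =
  conj_transform f x - conj_transform g x.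
Proof.
move=> Lf Lg; rewrite /conj_transform -cintegralB; [|exact: L1_kernel_r..].
by congr cintegral; apply/funext => y; rewrite mulrBr.
Qed.


(** Fubini: the integrand is dominated by [normc c * M * normc (phi xi) * normc (f x)], which is
    integrable on the product because both functions are in L^1. *)
Lemma kernel_adjoint (phi f : T -> R[i]) : L1 phi -> L1 f ->
  \int[mu]_xi complex.Re (phi xi * (c * cintegral mu (fun x => K xi x * f x))^*)
  = \int[mu]_x complex.Re (c^* * conj_transform phi x * (f x)^*).
Proof.
move=> Lphi Lf; have [mphi _] := Lphi; have [mf _] := Lf.
(* Real parts do not see conjugation, so the conjugate is moved from the inner integral to [phi];
   the integrand then is linear in [K] and in [f]. *)
pose H (z : T * T) := complex.Re ((phi z.1)^* * c * (K z.1 z.2 * f z.2)).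
have mHc : cmeasurable (fun z : T * T => (phi z.1)^* * c * (K z.1 z.2 * f z.2)).
  apply: cmeasurableM; apply: cmeasurableM => //.
  - exact/cmeasurable_conj/(cmeasurable_comp mphi measurable_fst).
  - exact: (cmeasurable_comp mf measurable_snd).
have mH : measurable_fun setT H by case: mHc.
have HE1 xi : \int[mu]_x H (xi, x) =
    complex.Re (phi xi * (c * cintegral mu (fun x => K xi x * f x))^*).
  rewrite /H /= -Re_mul_cintegral; last exact: L1_kernel_l.
  rewrite !(complexReM, complexImM, complexReJ, complexImJ); ring.
have HE2 x : \int[mu]_xi H (xi, x) =
    complex.Re (c^* * conj_transform phi x * (f x)^*).
  transitivity (complex.Re (c^* * (f x)^* * conj_transform phi x)).
    rewrite Re_mul_cintegral; last exact: L1_kernel_r.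
    apply: eq_Rintegral => xi _; rewrite /H /=.
    rewrite !(complexReM, complexImM, complexReJ, complexImJ); ring.
  rewrite !(complexReM, complexImM, complexReJ, complexImJ); ring.
have L1H1 xi : L1 (fun x => (phi xi)^* * c * (K xi x * f x)).
  have := L1_kernel_l xi Lf => Lk; have [mk _] := Lk.
  apply: (L1_normc_le (M := normc ((phi xi)^* * c)) Lk).
    by apply: cmeasurableM => //; exact: cmeasurable_cst.
  by move=> x; rewrite Normc.normcM.
have L1H2 x : L1 (fun xi => (phi xi)^* * c * (K xi x * f x)).
  have := L1_kernel_r x Lphi => Lk.
  apply: (L1_normc_le (M := normc (c * f x)) Lk).
    apply: cmeasurableM; apply: cmeasurableM => //.
    - exact: cmeasurable_conj.
    - exact: cmeasurable_kernel_r.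
  move=> xi; rewrite !Normc.normcM !normc_conj.
  by rewrite [leLHS](_ : _ = normc c * normc (f x) *
    (normc (K xi x) * normc (phi xi))) //; ring.
have nphi : mu.-integrable setT (EFin \o (fun x => normc (phi x))).
  apply: (integrable_le_normc (M := 1) Lphi); first exact: measurable_normc.
  by move=> y; rewrite mul1r ger0_norm ?normc_ge0.
have nf : mu.-integrable setT (EFin \o (fun x => normc (f x))).
  apply: (integrable_le_normc (M := 1) Lf); first exact: measurable_normc.
  by move=> y; rewrite mul1r ger0_norm ?normc_ge0.
have iH : (mu \x mu)%E.-integrable setT (EFin \o H).
  apply/integrable12ltyP; first exact/measurable_EFinP.
  pose C := normc c * M * \int[mu]_x normc (f x).
  apply: (@le_lt_trans _ _ (\int[mu]_xi (C * normc (phi xi))%:E)%E); last first.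
    apply: integrable_lty => //.
    exact: (integrableZl measurableT C nphi).
  apply: ge0_le_integral => //.
  - by move=> xi _; exact: integral_ge0.
  - apply: (measurable_fun_fubini_tonelli_F (fun z => `|(H z)%:E|%E)) => //.
    by apply: measurableT_comp => //; exact/measurable_EFinP.
  - by apply/measurable_EFinP/measurable_funM => //; exact: measurable_normc.
  move=> xi _.
  rewrite (_ : (C * normc (phi xi))%:E =
      \int[mu]_x ((normc c * M * normc (phi xi)) * normc (f x))%:E)%E; last first.
    rewrite /C /Rintegral mulrAC EFinM fineK; last exact: integrable_fin_num.
    by rewrite -integralZl.
  apply: ge0_le_integral => //.
  - apply/measurable_EFinP/measurableT_comp => //.
    by have [[]] := L1H1 xi.
  - by apply/measurable_EFinP/measurable_funM => //; exact: measurable_normc.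
  - move=> x _; rewrite lee_fin (le_trans (Re_le_normc _))//.
    rewrite !Normc.normcM normc_conj.
    rewrite [leLHS](_ : _ = (normc c * normc (phi xi) * normc (f x)) *
      normc (K xi x)); last by ring.
    rewrite [leRHS](_ : _ = (normc c * normc (phi xi) * normc (f x)) * M);
      last by ring.
    by rewrite ler_wpM2l ?mulr_ge0 ?normc_ge0.
have fin1 xi : (\int[mu]_x (H (xi, x))%:E = (\int[mu]_x H (xi, x))%:E)%E.
  rewrite fineK//; apply: integrable_fin_num => //.
  exact: (integrable_Re (L1H1 xi)).
have fin2 x : (\int[mu]_xi (H (xi, x))%:E = (\int[mu]_xi H (xi, x))%:E)%E.
  rewrite fineK//; apply: integrable_fin_num => //.
  exact: (integrable_Re (L1H2 x)).
have /(congr1 fine) := Fubini iH.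
under eq_integral do rewrite /= fin1 HE1.
by under [X in _ = fine X -> _]eq_integral do rewrite /= fin2 HE2.
Qed.

Variable F : (T -> R[i]) -> T -> R[i].
Hypothesis F_L2 : forall f, L2 f -> L2 (F f).
Hypothesis F_linear : linear_on_L2 mu F.
Hypothesis F_isometry : forall f, L2 f -> energy mu (F f) = energy mu f.
Hypothesis F_kernel : forall f, L1 f -> L2 f ->
  F f = (fun xi => c * cintegral mu (fun x => K xi x * f x)) %[ae mu].

Lemma energy_ae_eq f g : cmeasurable f -> cmeasurable g ->
  f = g %[ae mu] -> energy mu f = energy mu g.
Proof. by move=> mf mg fg; rewrite -!cnorm2_sqr (cnorm2_ae_eq mf mg fg). Qed.

(** Polarization: the energies of [f + g] and of its image are equal, and so are those of [f] and
    [g] and their images; the cross terms remain. *)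
Lemma isometry_cdot f g : L2 f -> L2 g -> cdot mu (F f) (F g) = cdot mu f g.
Proof.
move=> Lf Lg; have LFf := F_L2 Lf; have LFg := F_L2 Lg.
have Lfg := L2D Lf Lg; have LFfg := F_L2 Lfg; have LFD := L2D LFf LFg.
have E : energy mu (F (fun x => f x + g x)) =
         energy mu (fun x => F f x + F g x).
  apply: energy_ae_eq; [by case: LFfg|by case: LFD|].
  have := F_linear 1 Lf Lg.
  rewrite (_ : (fun x => 1 * f x + g x) = (fun x => f x + g x)); last first.
    by apply/funext => x; rewrite mul1r.
  by apply: filterS => x + _ => ->; rewrite // mul1r.
have := congr1 fine E; rewrite F_isometry// !energyD// !F_isometry//.
lra.
Qed.

(** Supplies the test functions of [inverse_kernel], since the kernel formula for [F] is known only
    on the intersection of L^1 and L^2. *)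
Lemma L1L2_finite_support (C : R) (A : set T) f : measurable A ->
  (mu A < +oo)%E -> cmeasurable f -> 0 <= C ->
  (forall x, normc (f x) <= C * \1_A x) -> L1 f /\ L2 f.
Proof.
move=> mA muA mf C0 fA; pose g x : R[i] := (\1_A x)%:C.
have mg : cmeasurable g by apply: cmeasurable_real; exact: measurable_indic.
have gE x : normc (g x) = \1_A x by rewrite normc_real ger0_norm.
split.
  apply: (L1_normc_le (M := C) (g := g)) => //; last by move=> x; rewrite gE.
  apply/inL1P; split=> //; under eq_integral do rewrite gE.
  by rewrite integral_indic// setIT.
have Lg : L2 g.
  apply/inL2P; split=> //; rewrite /energy.
  under eq_integral do rewrite gE indicE -natrX -mulnn mulnb andbb -indicE.
  by rewrite integral_indic// setIT.
have [mCg Cgo] := L2Z C%:C Lg.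
split=> //; apply: le_lt_trans Cgo; apply: cnorm2_le_ae => //.
by apply: aeW => x; rewrite Normc.normcM gE normc_real ger0_norm.
Qed.

Lemma inverse_kernel (phi v : T -> R[i]) : L1 phi -> L2 v ->
  F v = phi %[ae mu] -> v = (fun x => c^* * conj_transform phi x) %[ae mu].
Proof.
move=> Lphi Lv Fv; have [mphi _] := Lphi; have [mv _] := Lv.
(* Z is orthogonal to each of its truncations to a set of finite measure where it
   is bounded: polarization moves the pairing with v to the F side, and Fubini
   moves it back to a pairing with w. *)
pose w x := c^* * conj_transform phi x; pose Z x := v x - w x.
have mw : cmeasurable w.
  apply: cmeasurableM; first exact: cmeasurable_cst.
  exact: cmeasurable_conj_transform.
have mZ : cmeasurable Z by exact: cmeasurableB.
have [E [ET ndE mE]] : exists E : (set T)^nat, [/\ setT = \bigcup_i E i,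
    {homo E : n m / (n <= m)%N >-> (n <= m)%O}
    & forall i, measurable (E i) /\ (mu (E i) < +oo)%E].
  by apply/sigma_finiteP; exact: sigma_finiteT.
pose A n := E n `&` [set x | normc (Z x) <= n%:R].
have mA n : measurable (A n).
  have [mEn _] := mE n; apply: measurable_fun_le => //.
  exact/measurable_funTS/measurable_normc.
have muA n : (mu (A n) < +oo)%E.
  have [mEn En] := mE n; apply: le_lt_trans En.
  by apply: le_measure; rewrite ?inE//; exact: subIsetl.
pose f n x := (\1_(A n) x)%:C * Z x.
have mf n : cmeasurable (f n).
  by apply: cmeasurableM => //; apply: cmeasurable_real; exact: measurable_indic.
have fA n x : normc (f n x) <= n%:R * \1_(A n) x.
  rewrite Normc.normcM normc_real indicE; case: (boolP (x \in A n)) => xA.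
    by rewrite normr1 mul1r mulr1; move: xA; rewrite inE => -[].
  by rewrite normr0 mul0r mulr0.
suff f0 n : f n = (fun=> 0) %[ae mu].
  have := ae_foralln (fun n => f0 n); apply: filterS => x fx _.
  have [i _ Ei] : (\bigcup_i E i) x by rewrite -ET.
  (* Beyond the index of a set [E i] containing [x] and beyond [normc (Z x)], the point lies in
     [A n], where [f n] is [Z] itself. *)
  pose n := maxn i (Num.bound (normc (Z x))).
  have xA : x \in A n.
    rewrite inE; split.
      by move: Ei; apply/subsetPset/ndE; exact: leq_maxl.
    rewrite /=; apply: (le_trans (ltW (archi_boundP (normc_ge0 _)))).
    by rewrite ler_nat leq_maxr.
  have := fx n I; rewrite /f indicE xA mul1r => /eqP.
  by rewrite subr_eq0 => /eqP.
have [Lf1 Lf2] := L1L2_finite_support (mA n) (muA n) (mf n) (ler0n _ n) (fA n).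
have LFf := F_L2 Lf2; have LFv := F_L2 Lv.
have iv := integrable_cdot Lv Lf2.
have iw : mu.-integrable setT (EFin \o (fun x => complex.Re (w x * (f n x)^*))).
  apply: (integrable_le_normc
    (M := normc c * (M * \int[mu]_xi normc (phi xi))) Lf1).
    by case: (cmeasurableM mw (cmeasurable_conj (mf n))).
  move=> x; apply: le_trans (Re_le_normc _) _.
  rewrite Normc.normcM normc_conj ler_wpM2r ?normc_ge0//.
  rewrite Normc.normcM normc_conj.
  by rewrite ler_wpM2l ?normc_ge0//; exact: normc_conj_transform.
apply: energy_eq0 => //.
have : cdot mu v (f n) = \int[mu]_x complex.Re (w x * (f n x)^*).
  rewrite -isometry_cdot// -kernel_adjoint//; congr fine.
  have mFK : cmeasurable (fun xi => c * cintegral mu (fun x => K xi x * f n x)).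
    apply: cmeasurableM; first exact: cmeasurable_cst.
    have mH : cmeasurable (fun z : T * T => K z.2 z.1 * f n z.1).
      apply: cmeasurableM; last exact: (cmeasurable_comp (mf n) measurable_fst).
      apply: (cmeasurable_comp (f := fun z : T * T => K z.1 z.2)
        (g := fun z : T * T => (z.2, z.1))) => //.
      exact: measurable_swap.
    exact: (cmeasurable_cintegral_fst mH).
  apply: ae_eq_integral => //.
  - by case: (cmeasurableM LFv.1 (cmeasurable_conj LFf.1)) => /measurable_EFinP.
  - by case: (cmeasurableM mphi (cmeasurable_conj mFK)) => /measurable_EFinP.
  - have Fk := F_kernel Lf1 Lf2.
    by near=> x => _; congr (complex.Re _)%:E; congr (_ * _^*);
      near: x; [apply: filterS Fv|apply: filterS Fk] => x; apply.
(* The difference of the two pairings is the pairing of [Z] with its truncation [f n], which is the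
   energy of [f n]. *)
move=> /eqP; rewrite -subr_eq0 -RintegralB// => /eqP E0.
rewrite -[LHS]fineK ?energy_fine//.
rewrite (_ : fine _ = 0)//.
rewrite -{}E0; apply: eq_Rintegral => x _.
rewrite normc_sqr -complexReN -mulNr -complexReD -mulrDl /f.
rewrite !(complexReM, complexImM, complexReJ, complexImJ) /=.
rewrite -/(Z x) indicE; case: (x \in A n); rewrite /=; ring.
Unshelve. all: by end_near.
Qed.

End inverse_kernel.

(** * Weak-type tails *)

Section weak_type.
Context d (T : measurableType d) (R : realType).
Variable mu : {measure set T -> \bar R}.

Lemma measurable_ge_set (f : T -> R) (s : R) : measurable_fun setT f ->
  measurable [set x | s <= f x].
Proof.
by move=> mf; rewrite -[X in measurable X]setTI; exact: measurable_fun_le.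
Qed.

Lemma measurable_le_set (f : T -> R) (s : R) : measurable_fun setT f ->
  measurable [set x | f x <= s].
Proof.
by move=> mf; rewrite -[X in measurable X]setTI; exact: measurable_fun_le.
Qed.

Lemma measurable_gt_set (f : T -> R) (s : R) : measurable_fun setT f ->
  measurable [set x | s < f x].
Proof.
move=> mf; rewrite (_ : [set x | _] = ~` [set x | f x <= s]).
  exact/measurableC/measurable_le_set.
by apply/seteqP; split=> x /=; rewrite ltNge; move/negP.
Qed.

Lemma nneseries_le_bound (u : nat -> R) (C : R) : (forall n, 0 <= u n) ->
  (forall n, \sum_(i < n) u i <= C) -> (\sum_(0 <= n <oo) (u n)%:E <= C%:E)%E.
Proof.
move=> u0 uC; apply: lime_le.
  by apply: is_cvg_nneseries => n _ _; rewrite lee_fin.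
by apply: nearW => n; rewrite sumEFin lee_fin big_mkord.
Qed.

Lemma nneseries_ge_term (u : nat -> R) n : (forall n, 0 <= u n) ->
  ((u n)%:E <= \sum_(0 <= n <oo) (u n)%:E)%E.
Proof.
move=> u0; apply: le_trans (nneseries_lim_ge n.+1 _); last first.
  by move=> i _ _; rewrite lee_fin.
by rewrite sumEFin lee_fin big_nat_recr//= lerDr sumr_ge0.
Qed.

Lemma dyadic_bracket (y : R) : 1 <= y -> exists j, 2 ^+ j <= y < 2 ^+ j.+1.
Proof.
move=> y1; have ex : exists j, y < 2 ^+ j.+1.
  exists (Num.bound y); apply: lt_trans (archi_boundP (le_trans ler01 y1)) _.
  by rewrite -natrX ltr_nat (ltn_trans (ltn_expl _ (ltnSn 1)))// ltn_exp2l.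
case: (ex_minnP ex) => -[|j] yj jmin.
  by exists 0%N; rewrite expr0 y1.
exists j.+1; rewrite yj andbT leNgt; apply/negP => /jmin.
by rewrite ltnn.
Qed.

(** The terms that survive the truncation are an initial piece of a geometric progression of ratio
    [q ^+ 2]. Its sum is at most [q ^+ 2 / (q ^+ 2 - 1)] times its last term, itself at most
    [kappa ^+ 2]. The bound depends neither on [b] nor on [n]. *)
Lemma geometric_truncated (q b kappa : R) n : 1 < q -> 0 <= b -> 0 <= kappa ->
  \sum_(j < n) (q ^+ j * b <= kappa)%R%:R * (q ^+ j * b) ^+ 2 <=
  q ^+ 2 / (q ^+ 2 - 1) * kappa ^+ 2.
Proof.
move=> q1 b0 k0; pose D := q ^+ 2 / (q ^+ 2 - 1).
have q2 : 1 < q ^+ 2 by rewrite expr_gt1// ltW// (lt_trans ltr01).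
have D1 : D * (q ^+ 2 - 1) = q ^+ 2 by rewrite /D mulfVK// subr_eq0 gt_eqF.
have D0 : 0 <= D by rewrite divr_ge0 ?sqr_ge0// subr_ge0 ltW.
rewrite -/D.
(* The induction carries a second bound, by the last power whether truncated or not; it reproduces
   itself because [D / q ^+ 2 + 1 = D]. *)
suff : \sum_(j < n) (q ^+ j * b <= kappa)%R%:R * (q ^+ j * b) ^+ 2 <=
    D * kappa ^+ 2 /\ (n != 0%N ->
    \sum_(j < n) (q ^+ j * b <= kappa)%R%:R * (q ^+ j * b) ^+ 2 <=
    D * (q ^+ n.-1 * b) ^+ 2) by case.
elim: n => [|n [IH1 IH2]].
  by rewrite big_ord0; split=> //; rewrite mulr_ge0 ?sqr_ge0.
set S := \sum_(j < n) _ in IH1 IH2.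
have S2 : S <= D * (q ^+ n * b) ^+ 2 / q ^+ 2.
  case: (n) @S IH1 IH2 => [|m] S _ /=.
    by rewrite /S big_ord0 divr_ge0 ?sqr_ge0// mulr_ge0 ?sqr_ge0.
  move=> /(_ isT) => /le_trans; apply.
  rewrite (exprS q m) le_eqVlt; apply/orP; left; apply/eqP; field.
  by rewrite gt_eqF// (lt_trans ltr01).
rewrite big_ord_recr /= -/S.
have S3 : S + (q ^+ n * b) ^+ 2 <= D * (q ^+ n * b) ^+ 2.
  apply: (le_trans (lerD S2 (lexx _))).
  rewrite le_eqVlt; apply/orP; left; apply/eqP.
  rewrite /D; field.
  by rewrite subr_eq0 gt_eqF// gt_eqF// (lt_trans ltr01).
have S4 : S <= D * (q ^+ n * b) ^+ 2.
  by apply: le_trans S3; rewrite lerDl sqr_ge0.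
case: (leP (q ^+ n * b) kappa) => qk.
  rewrite mul1r; split=> //; apply: le_trans S3 _.
  rewrite ler_wpM2l// ler_pXn2r// nnegrE// mulr_ge0// exprn_ge0//.
  exact: ltW (lt_trans ltr01 q1).
by rewrite mul0r addr0.
Qed.

(** Dyadic layers: where [H] exceeds [s], some [j] has [2 ^+ j * s <= H < 2 ^+ j.+1 * s], so
    [H ^+ 2] is at most 4 times the sum over [j] of [(2 ^+ j * s) ^+ 2] on [A j]. By the weak bound
    the integrals are dominated by a geometric series of ratio [rho], which is below 1 since [r]
    exceeds 2. *)
Lemma weak_type_tail (H : T -> R) (W r : R) : measurable_fun setT H ->
  (forall x, 0 <= H x) -> 0 <= W -> 2 < r ->
  (forall s, 0 < s -> (mu [set x | (s <= H x)%R] <= ((W / s) `^ r)%:E)%E) ->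
  exists2 C : R, 0 <= C & forall s, 0 < s ->
    (\int[mu]_x (\1_[set x | (s < H x)%R] x * H x ^+ 2)%:E <=
      (C * s `^ (2 - r))%:E)%E.
Proof.
move=> mH H0 W0 r2 Hweak; pose rho : R := 2 `^ (2 - r).
have rho0 : 0 <= rho by exact: powR_ge0.
have rho1 : rho < 1.
  rewrite /rho -opprB powRN invf_lt1 ?powR_gt0//.
  have : 1 `^ (r - 2) < 2 `^ (r - 2) :> R.
    by rewrite gt0_ltr_powR ?nnegrE ?subr_gt0 ?ltr1n.
  by rewrite powR1.
exists (4 * W `^ r / (1 - rho)).
  by rewrite divr_ge0 ?subr_ge0 ?(ltW rho1)// mulr_ge0 ?powR_ge0.
move=> s s0; pose A j := [set x | 2 ^+ j * s <= H x].
have mA j : measurable (A j).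
  exact: measurable_ge_set.
have p2 j : 0 < (2 : R) ^+ j by rewrite exprn_gt0.
have t0 x j : 0 <= 4 * (2 ^+ j * s) ^+ 2 * \1_(A j) x :> R.
  by rewrite mulr_ge0// mulr_ge0 ?sqr_ge0.
apply: (@le_trans _ _
    (\int[mu]_x \sum_(0 <= j <oo) (4 * (2 ^+ j * s) ^+ 2 * \1_(A j) x)%:E)%E).
  apply: ge0_le_integral => //.
  - by move=> x _; rewrite lee_fin mulr_ge0 ?sqr_ge0.
  - apply/measurable_EFinP; apply: measurable_funM; last exact: measurable_funX.
    exact/measurable_indic/measurable_gt_set.
  - apply: ge0_emeasurable_sum => [j x _ _|j _].
      by rewrite lee_fin.
    by apply/measurable_EFinP; exact: measurable_funM.
  move=> x _.
  rewrite indicE; case: (boolP (_ \in _)) => [|_]; last first.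
    by rewrite mul0r; apply: nneseries_ge0 => j _ _; rewrite lee_fin.
  rewrite inE /= mul1r => sH.
  have [j /andP[j1 j2]] : exists j, 2 ^+ j <= H x / s < 2 ^+ j.+1.
    by apply: dyadic_bracket; rewrite ler_pdivlMr// mul1r ltW.
  apply: le_trans (nneseries_ge_term j (t0 x)).
  rewrite lee_fin indicE mem_set ?mulr1; last first.
    by rewrite /A /= -ler_pdivlMr.
  rewrite (_ : 4 * _ = (2 ^+ j.+1 * s) ^+ 2);
    last by rewrite (exprS (2 : R) j); ring.
  rewrite ler_pXn2r ?nnegrE// ?mulr_ge0 ?exprn_ge0 ?(ltW s0)//.
  by rewrite -ler_pdivrMr// ltW.
rewrite integral_nneseries//; last 2 first.
- move=> j; apply/measurable_EFinP/measurable_funM => //.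
- by move=> j x _; rewrite lee_fin.
apply: (@le_trans _ _
    (\sum_(0 <= j <oo) (4 * W `^ r * s `^ (2 - r) * rho ^+ j)%:E)%E).
  apply: lee_nneseries => [j _ _|j _].
    by apply: integral_ge0 => x _; rewrite lee_fin.
  under eq_integral do rewrite EFinM.
  rewrite ge0_integralZl//; last 2 first.
  - exact/measurable_EFinP.
  - by rewrite lee_fin mulr_ge0 ?sqr_ge0.
  rewrite integral_indic// setIT.
  have tgt0 : 0 < 2 ^+ j * s by rewrite mulr_gt0.
  apply: (@le_trans _ _ ((4 * (2 ^+ j * s) ^+ 2)%:E *
      ((W / (2 ^+ j * s)) `^ r)%:E)%E).
    by rewrite lee_wpmul2l ?Hweak// lee_fin mulr_ge0 ?sqr_ge0.
  rewrite -EFinM lee_fin le_eqVlt; apply/orP; left; apply/eqP.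
  have -> : rho ^+ j = (2 ^+ j) `^ (2 - r).
    by rewrite -[2 ^+ j]powR_mulrn// -powRrM mulrC powRrM powR_mulrn.
  rewrite -mulrA -powRM// ?(ltW s0)// ?exprn_ge0// (mulrC s).
  set t := 2 ^+ j * s in tgt0 *.
  rewrite powRM ?invr_ge0 ?(ltW tgt0)// -(powR_inv1 (ltW tgt0)) -powRrM mulN1r.
  rewrite powRD; last by apply/implyP => _; rewrite gt_eqF.
  by rewrite powR_mulrn ?(ltW tgt0)//; ring.
apply: nneseries_le_bound => [j|n].
  by rewrite !mulr_ge0 ?powR_ge0// exprn_ge0.
rewrite -mulr_sumr [leRHS]mulrAC ler_wpM2l ?mulr_ge0 ?powR_ge0//.
rewrite -[leRHS]mul1r ler_pdivlMr ?subr_gt0// mulrC -opprB mulNr -subrX1.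
by rewrite opprB gerBl exprn_ge0.
Qed.
End weak_type.

(** * From level estimates to a strong bound *)

Section strong_type.
Context d (T : measurableType d) (R : realType).
Variable mu : {measure set T -> \bar R}.
Implicit Types f g : T -> R[i].
Local Notation L1 := (inLp mu 1%:E).
Local Notation L2 := (inLp mu 2%:E).

(** The tail decays with exponent [2 - r = - (2 / (p - 1))] in the cut, so a cut proportional to
    lambda^(-(p-1)) leaves a tail proportional to [lambda ^+ 2]. *)
Lemma tail_level (H : T -> R) (W p : R) : measurable_fun setT H ->
  (forall x, 0 <= H x) -> 0 <= W -> 1 < p ->
  (forall s, 0 < s ->
    (mu [set x | (s <= H x)%R] <= ((W / s) `^ (2 * p / (p - 1)))%:E)%E) ->
  forall eta : R, 0 < eta -> exists2 kappa : R, 0 < kappa &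
    forall lambda, 0 < lambda ->
    (\int[mu]_x (\1_[set x | (kappa / lambda `^ (p - 1) < H x)%R] x
      * H x ^+ 2)%:E <= ((eta * lambda) ^+ 2)%:E)%E.
Proof.
move=> mH H0 W0 p1 Hweak eta eta0.
have p10 : 0 < p - 1 by rewrite subr_gt0.
have r2 : 2 < 2 * p / (p - 1).
  by rewrite ltr_pdivlMr// ltr_pM2l// ltrBlDr ltrDl.
have [C C0 HC] := weak_type_tail mH H0 W0 r2 Hweak.
have rE : 2 - 2 * p / (p - 1) = - (2 / (p - 1)).
  by field; rewrite gt_eqF.
(* [E] is [kappa] to the power [2 / (p - 1)], so the tail is at most [C / E * lambda ^+ 2]. The
   added 1 keeps [kappa] positive when [C] is 0. *)
pose E := (C + 1) / eta ^+ 2.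
have E0 : 0 < E by rewrite divr_gt0 ?exprn_gt0// ltr_wpDl.
exists (E `^ ((p - 1) / 2)); first exact: powR_gt0.
move=> lambda l0; set s := _ / _.
have s0 : 0 < s by rewrite divr_gt0// powR_gt0.
apply: le_trans (HC s s0) _; rewrite lee_fin rE.
have -> : s `^ (- (2 / (p - 1))) = E^-1 * lambda ^+ 2.
  rewrite /s powRM ?invr_ge0 ?powR_ge0//; congr (_ * _).
    rewrite -powRrM (_ : _ * _ = -1) ?powR_inv1 ?(ltW E0)//.
    by field; rewrite gt_eqF.
  rewrite -powRN -powRrM (_ : _ * _ = 2%:R) ?powR_mulrn ?(ltW l0)//.
  by field; rewrite gt_eqF.
rewrite /E exprMn mulrA ler_wpM2r ?sqr_ge0// invf_div mulrCA ger_pMr.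
  by rewrite ler_pdivrMr ?mul1r ?ler_wpDr// ltr_wpDl.
by rewrite exprn_gt0.
Qed.

(** The levels [2 ^+ j / 2 ^+ n], with [j] a natural number, reach only the points where
    [normc (w x)] is at least [2 ^- n]. The resulting bound is independent of [n], and monotone
    convergence removes the restriction. *)
Lemma strong_type_of_levels (w g h : T -> R[i]) (kappa p : R) :
  cmeasurable w -> cmeasurable g -> cmeasurable h ->
  0 < kappa -> 1 < p -> (energy mu g <= 1)%E ->
  let q := 2 `^ (p - 1) in
  (forall lambda, 0 < lambda -> exists u, [/\ L2 u,
    energy mu u = energy mu (fun x =>
      (\1_[set x | normc (h x) <= kappa / lambda `^ (p - 1)] x)%:C * (h x * g x))
    & {ae mu, forall x, normc (w x - u x) <= lambda / 2}]) ->
  (\int[mu]_x (normc (w x) `^ (2 * p))%:E <=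
    (4 * q ^+ 2 * (q ^+ 2 / (q ^+ 2 - 1) * kappa ^+ 2))%:E)%E.
Proof.
move=> mw mg mh k0 p1 g1 q levels.
have p10 : 0 < p - 1 by rewrite subr_gt0.
have q1 : 1 < q.
  have : 1 `^ (p - 1) < 2 `^ (p - 1) :> R.
    by rewrite gt0_ltr_powR ?nnegrE ?ltr1n.
  by rewrite powR1.
have q0 : 0 < q := lt_trans ltr01 q1.
have qn n : 0 < q ^+ n by rewrite exprn_gt0.
have p2 n : 0 < (2 : R) ^+ n by rewrite exprn_gt0.
set C := (4 * _ * _).
have mnw := measurable_normc mw.
have mwp : measurable_fun setT (fun x => (normc (w x) `^ (2 * p))%:E).
  apply/measurable_EFinP.
  exact: (measurableT_comp (measurable_powR _) mnw).
(* The zero set of [w], where the integrand vanishes, is put into every [A n] so that the union is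
   the whole space. *)
pose A n := [set x | normc (w x) <= 0] `|` [set x | 2 ^- n <= normc (w x)].
have mA n : measurable (A n).
  by apply: measurableU; [exact: measurable_le_set|exact: measurable_ge_set].
have -> : (\int[mu]_x (normc (w x) `^ (2 * p))%:E =
    \int[mu]_(x in \bigcup_n A n) (normc (w x) `^ (2 * p))%:E)%E.
  congr (integral _ _ _); apply/esym/seteqP; split=> // x _.
  have [w0|w0] := leP (normc (w x)) 0; first by exists 0%N => //; left.
  exists (Num.bound (normc (w x))^-1) => //; right => /=.
  rewrite -[leRHS]invrK lef_pV2 ?posrE ?invr_gt0// ltW//.
  apply: lt_trans (archi_boundP _) _; first by rewrite invr_ge0 ltW.
  by rewrite -natrX ltr_nat ltn_expl.
have cvA : (\int[mu]_(x in A n) (normc (w x) `^ (2 * p))%:E)%E @[n --> \oo] -->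
    (\int[mu]_(x in \bigcup_n A n) (normc (w x) `^ (2 * p))%:E)%E.
  apply: ge0_nondecreasing_set_cvg_integral => //.
  - move=> m n mn; apply/subsetPset; apply: setUS => x /=; apply: le_trans.
    by rewrite lef_pV2 ?posrE// ler_eXn2l// ltr1n.
  - by move=> n; apply: measurable_funTS.
  - by move=> n x _; rewrite lee_fin powR_ge0.
rewrite -(cvg_lim _ cvA)//; apply: lime_le.
  by apply/cvg_ex; eexists; exact: cvA.
apply: nearW => n.
pose lam j : R := 2 ^+ j / 2 ^+ n.
have lam0 j : 0 < lam j by rewrite divr_gt0.
have /choice[u uP] : forall j, exists u, [/\ L2 u,
    energy mu u = energy mu (fun x =>
      (\1_[set x | normc (h x) <= kappa / lam j `^ (p - 1)] x)%:C * (h x * g x))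
    & {ae mu, forall x, normc (w x - u x) <= lam j / 2}].
  by move=> j; exact: levels.
have lamE j : lam j `^ (p - 1) = q ^+ j / q ^+ n.
  have H m : (2 ^+ m) `^ (p - 1) = q ^+ m.
    by rewrite -[2 ^+ m]powR_mulrn// -powRrM mulrC powRrM powR_mulrn ?powR_ge0.
  rewrite powRM ?invr_ge0// ?(ltW (p2 _))//.
  by rewrite -(powR_inv1 (ltW (p2 n))) -powRrM mulN1r powRN !H.
have mu_ j : cmeasurable (u j) by have [[]] := uP j.
(* A majorant of |w|^2 |w|^(2(p-1)) where [lam j <= normc (w x) <= 2 * lam j]: the first factor is
   at most [4 * normc (u j x) ^+ 2], the second at most [q ^+ 2] times the square of lam_j^(p-1),
   which is [q ^+ j / q ^+ n]. *)
pose t j x : R := 4 * q ^+ 2 * (q ^+ j / q ^+ n) ^+ 2 * normc (u j x) ^+ 2.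
have c0 : 0 <= 4 * q ^+ 2 by rewrite mulr_ge0 ?sqr_ge0.
have t0 j x : 0 <= t j x.
  by rewrite /t mulr_ge0 ?sqr_ge0// mulr_ge0 ?sqr_ge0.
have mt j : measurable_fun setT (fun x => (t j x)%:E).
  by apply/measurable_EFinP/measurable_funM => //;
    exact/measurable_funX/measurable_normc.
(* In terms of [b] the cut on [h] at level [j] reads [q ^+ j * b x <= kappa], the form taken by
   [geometric_truncated]. *)
pose b x := normc (h x) / q ^+ n.
pose e j x := 4 * q ^+ 2 * ((q ^+ j * b x <= kappa)%R%:R * (q ^+ j * b x) ^+ 2)
  * normc (g x) ^+ 2.
have e0 j x : 0 <= e j x.
  by rewrite /e mulr_ge0 ?sqr_ge0// mulr_ge0// mulr_ge0 ?sqr_ge0.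
have me j : measurable_fun setT (fun x => (e j x)%:E).
  have mb : measurable_fun setT (fun x => q ^+ j * b x).
    by apply: measurable_funM => //; apply: measurable_funM => //;
      exact: measurable_normc.
  apply/measurable_EFinP/measurable_funM;
    last exact/measurable_funX/measurable_normc.
  apply: measurable_funM => //; apply: measurable_funM; last exact: measurable_funX.
  rewrite (_ : (fun _ => _) = \1_[set x | q ^+ j * b x <= kappa]).
    exact/measurable_indic/measurable_le_set.
  apply/funext => x; rewrite indicE; congr ((nat_of_bool _)%:R).
  by apply/idP/idP; rewrite inE.
have tE j : (\int[mu]_x (t j x)%:E = \int[mu]_x (e j x)%:E)%E.
  have [_ uE _] := uP j.
  have mD : measurable [set x | normc (h x) <= kappa / lam j `^ (p - 1)].
    exact/measurable_le_set/measurable_normc.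
  have mv : cmeasurable (fun x =>
      (\1_[set x | normc (h x) <= kappa / lam j `^ (p - 1)] x)%:C * (h x * g x)).
    apply: cmeasurableM; last exact: cmeasurableM.
    by apply: cmeasurable_real; exact: measurable_indic.
  transitivity ((4 * q ^+ 2 * (q ^+ j / q ^+ n) ^+ 2)%:E * energy mu (u j))%E.
    rewrite -ge0_integralZl//=.
    - exact: measurable_normc_sqr.
    - by move=> x _; rewrite lee_fin sqr_ge0.
    - by rewrite lee_fin mulr_ge0 ?sqr_ge0.
  rewrite uE -ge0_integralZl//=; last 3 first.
  - exact: measurable_normc_sqr.
  - by move=> x _; rewrite lee_fin sqr_ge0.
  - by rewrite lee_fin mulr_ge0 ?sqr_ge0.
  apply: eq_integral => x _; rewrite -EFinM; congr EFin.
  rewrite !Normc.normcM normc_real indicE lamE /e /b.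
  have -> : (x \in [set x | normc (h x) <= kappa / (q ^+ j / q ^+ n)]) =
      (q ^+ j * (normc (h x) / q ^+ n) <= kappa).
    apply/idP/idP; rewrite inE /= ler_pdivlMr ?divr_gt0//;
      by rewrite mulrCA mulrA.
  case: (_ <= kappa); first by rewrite normr1 mulr1n; field; rewrite gt_eqF.
  by rewrite normr0 mulr0n; field; rewrite gt_eqF.
have msumt : measurable_fun setT (fun x => \sum_(0 <= j <oo) (t j x)%:E)%E.
  by apply: ge0_emeasurable_sum => // j x _ _; rewrite lee_fin.
have sumt0 x : (0 <= \sum_(0 <= j <oo) (t j x)%:E)%E.
  by apply: nneseries_ge0 => j _ _; rewrite lee_fin.
apply: (@le_trans _ _ (\int[mu]_(x in A n) \sum_(0 <= j <oo) (t j x)%:E)%E).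
  apply: ae_ge0_le_integral => //.
  - by move=> x _; rewrite lee_fin powR_ge0.
  - exact: measurable_funTS.
  - exact: measurable_funTS.
  have /ae_foralln : forall j, {ae mu, forall x, normc (w x - u j x) <= lam j / 2}.
    by move=> j; have [] := uP j.
  apply: filterS => x wu [w0|wn].
    have -> : normc (w x) = 0 by apply/eqP; rewrite eq_le w0 normc_ge0.
    by rewrite powR0// mulf_neq0// gt_eqF// (lt_trans ltr01).
  have [j /andP[j1 j2]] : exists j, 2 ^+ j <= normc (w x) * 2 ^+ n < 2 ^+ j.+1.
    by apply: dyadic_bracket; rewrite -ler_pdivrMr// div1r.
  apply: le_trans (nneseries_ge_term j (t0 ^~ x)).
  rewrite lee_fin (_ : 2 * p = 2%:R + (p - 1) * 2%:R); last by ring.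
  rewrite powRD; last first.
    apply/implyP => _; rewrite gt_eqF//; apply: lt_le_trans (lam0 j) _.
    by rewrite ler_pdivrMr.
  rewrite powRrM !powR_mulrn ?powR_ge0 ?normc_ge0//.
  have wl : lam j <= normc (w x) by rewrite ler_pdivrMr.
  have wl2 : normc (w x) <= 2 * lam j.
    by rewrite /lam mulrA -exprS ler_pdivlMr// ltW.
  (* The error [lam j / 2] is at most half of [normc (w x)] and is absorbed on the left. *)
  have uw : normc (w x) <= 2 * normc (u j x).
    have := wu j; have := normcD (w x - u j x) (u j x); rewrite subrK; lra.
  have wp : normc (w x) `^ (p - 1) <= q * (q ^+ j / q ^+ n).
    rewrite -lamE /q -powRM// ?(ltW (lam0 j))//.
    by rewrite ge0_ler_powR ?nnegrE ?normc_ge0 ?mulr_ge0 ?(ltW (lam0 j)) ?(ltW p10).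
  apply: (@le_trans _ _ ((2 * normc (u j x)) ^+ 2 * (q * (q ^+ j / q ^+ n)) ^+ 2)).
    apply: ler_pM; rewrite ?sqr_ge0//.
      by rewrite ler_pXn2r ?nnegrE ?mulr_ge0 ?normc_ge0.
    rewrite ler_pXn2r ?nnegrE ?powR_ge0//.
    by rewrite mulr_ge0 ?divr_ge0 ?(ltW q0) ?(ltW (qn _)).
  by rewrite /t le_eqVlt; apply/orP; left; apply/eqP; ring.
apply: (@le_trans _ _ (\int[mu]_x \sum_(0 <= j <oo) (t j x)%:E)%E).
  exact: ge0_subset_integral.
rewrite integral_nneseries//; last by move=> j x _; rewrite lee_fin.
under eq_eseriesr do rewrite tE.
rewrite -integral_nneseries//; last by move=> j x _; rewrite lee_fin.
have q2 : 1 < q ^+ 2 by rewrite expr_gt1// ltW.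
have C0 : 0 <= C.
  rewrite /C mulr_ge0// mulr_ge0 ?sqr_ge0// divr_ge0 ?sqr_ge0//.
  by rewrite subr_ge0 ltW.
have mg2 := measurable_normc_sqr mg.
apply: (@le_trans _ _ (\int[mu]_x (C * normc (g x) ^+ 2)%:E)%E).
  apply: ge0_le_integral => //.
  - by move=> x _; apply: nneseries_ge0 => j _ _; rewrite lee_fin.
  - by apply: ge0_emeasurable_sum => // j x _ _; rewrite lee_fin.
  - by apply/measurable_EFinP/measurable_funM => //; exact/measurable_EFinP.
  move=> x _; apply: nneseries_le_bound => // m.
  rewrite /e -mulr_suml -mulr_sumr ler_wpM2r ?sqr_ge0// ler_wpM2l//.
  apply: geometric_truncated => //; last exact: ltW.
  by rewrite divr_ge0 ?normc_ge0// ltW.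
under eq_integral do rewrite EFinM.
rewrite ge0_integralZl//; last by move=> x _; rewrite lee_fin sqr_ge0.
by rewrite -[leRHS]mule1 lee_wpmul2l ?lee_fin.
Qed.

End strong_type.

(** * Bounds for the multiplier *)

Section multiplier.
Context d (T : measurableType d) (R : realType).
Variable mu : {sigma_finite_measure set T -> \bar R}.
Implicit Types f g : T -> R[i].
Local Notation L1 := (inLp mu 1%:E).
Local Notation L2 := (inLp mu 2%:E).

Variables (K : T -> T -> R[i]) (M : R) (c : R[i]).
Hypothesis mK : cmeasurable (fun z : T * T => K z.1 z.2).
Hypothesis KM : forall x y, normc (K x y) <= M.
Variable F : (T -> R[i]) -> T -> R[i].
Hypothesis F_L2 : forall f, L2 f -> L2 (F f).
Hypothesis F_linear : linear_on_L2 mu F.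
Hypothesis F_isometry : forall f, L2 f -> energy mu (F f) = energy mu f.
Hypothesis F_surj : forall g, L2 g -> exists2 f, L2 f & F f = g %[ae mu].
Hypothesis F_kernel : forall f, L1 f -> L2 f ->
  F f = (fun xi => c * cintegral mu (fun x => K xi x * f x)) %[ae mu].

(** The counterpart of [ka_fourier_inv] over an abstract space: some splitting of [g] is provided,
    not one of a prescribed form. *)
Definition inverse_image g w : Prop := exists g1 g2 v,
  [/\ L1 g1, L2 g2, g = (fun xi => g1 xi + g2 xi) %[ae mu],
      L2 v /\ F v = g2 %[ae mu]
    & w = (fun x => c^* * conj_transform mu K g1 x + v x) %[ae mu]].

(** Almost everywhere [g1 - G1 = G2 - g2]; this is in L^1 and is the image of [u - v]. So
    [inverse_kernel] computes [u - v], and [w - u] is left as the kernel integral of [G1], which is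
    bounded because the kernel is. *)
Lemma inverse_image_split g w G1 G2 : inverse_image g w ->
  L1 G1 -> L2 G2 -> (forall x, g x = G1 x + G2 x) ->
  exists u, [/\ L2 u, energy mu u = energy mu G2 & {ae mu, forall x,
    normc (w x - u x) <= normc c * (M * \int[mu]_xi normc (G1 xi))}].
Proof.
move=> [g1 [g2 [v [Lg1 Lg2 gE [Lv Fv] wE]]]] LG1 LG2 gG.
have [u Lu Fu] := F_surj LG2.
exists u; split=> //.
  rewrite -(F_isometry Lu); apply: energy_ae_eq => //.
    by have [] := F_L2 Lu.
  by case: LG2.
pose phi x := g1 x - G1 x.
have Lphi : L1 phi by exact: L1B.
pose e x := u x - v x.
have Le : L2 e by exact: L2B.
have eE : e = (fun x => (-1) * v x + u x).
  by apply/funext => x; rewrite /e mulN1r addrC.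
have Fe : F e = phi %[ae mu].
  have Flin := F_linear (-1) Lv Lu; rewrite -eE in Flin.
  have FvFu : \forall x \ae mu, F v x = g2 x /\ F u x = G2 x.
    by move: Fv Fu; apply: filterS2 => x /(_ I) ? /(_ I).
  move: Flin gE FvFu; apply: filterS3 => x Fx gx [Fvx Fux] _.
  rewrite Fx// Fvx Fux /phi.
  have /eqP := gG x; rewrite gx// => /eqP E.
  have -> : G2 x = g1 x + g2 x - G1 x by rewrite E addrAC subrr add0r.
  by rewrite mulN1r; ring.
have := inverse_kernel mK KM F_L2 F_linear F_isometry F_kernel Lphi Le Fe.
move: wE; apply: filterS2 => x wx ex.
have -> : w x - u x = c^* * conj_transform mu K G1 x.
  have := ex I; rewrite (conj_transformB mK KM)// /e mulrBr => E.
  by rewrite wx// -[u x](subrK (v x)) E; ring.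
rewrite Normc.normcM normc_conj ler_wpM2l ?normc_ge0//.
exact: normc_conj_transform.
Qed.

Variables (h : T -> R[i]) (W p : R).
Hypothesis mh : cmeasurable h.
Hypothesis W0 : 0 <= W.
Hypothesis p1 : 1 < p.
Hypothesis h_weak : forall s, 0 < s ->
  (mu [set x | (s <= normc (h x))%R] <= ((W / s) `^ (2 * p / (p - 1)))%:E)%E.

Lemma multiplier_unit_bound : exists2 C : R, 0 <= C & forall g w, L2 g ->
  (energy mu g <= 1)%E -> cmeasurable w ->
  inverse_image (fun x => h x * g x) w ->
  (\int[mu]_x (normc (w x) `^ (2 * p))%:E <= C%:E)%E.
Proof.
pose a := normc c * `|M|.
have a0 : 0 <= a by rewrite mulr_ge0 ?normc_ge0.
(* With this [eta] the kernel term is at most [a * eta * lambda <= lambda / 2]; the added 1 covers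
   [a = 0]. *)
pose eta := (2 * (a + 1))^-1.
have eta0 : 0 < eta by rewrite invr_gt0 mulr_gt0// ltr_wpDl.
have mnh := measurable_normc mh.
have [kappa k0 tail] := tail_level mnh (fun x => normc_ge0 (h x)) W0 p1 h_weak eta0.
pose q : R := 2 `^ (p - 1).
have q1 : 1 < q.
  have : 1 `^ (p - 1) < 2 `^ (p - 1) :> R.
    by rewrite gt0_ltr_powR ?nnegrE ?ltr1n ?subr_gt0.
  by rewrite powR1.
exists (4 * q ^+ 2 * (q ^+ 2 / (q ^+ 2 - 1) * kappa ^+ 2)).
  have q2 : 1 < q ^+ 2 by rewrite expr_gt1// ltW// (lt_trans ltr01).
  rewrite mulr_ge0//; first by rewrite mulr_ge0 ?sqr_ge0.
  by rewrite mulr_ge0 ?sqr_ge0// divr_ge0 ?sqr_ge0// subr_ge0 ltW.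
move=> g w Lg g1 mw ww; have [mg _] := Lg.
apply: (strong_type_of_levels mw mg mh k0 p1 g1) => lambda l0.
set s := kappa / _.
have s0 : 0 < s by rewrite divr_gt0// powR_gt0.
set D := [set x | _].
have mD : measurable D by exact: measurable_le_set.
pose E := [set x | s < normc (h x)].
have mE : measurable E by exact: measurable_gt_set.
pose G1 x := (\1_E x)%:C * (h x * g x).
pose G2 x := (\1_D x)%:C * (h x * g x).
have mhg := cmeasurableM mh mg.
have mG1 : cmeasurable G1.
  by apply: cmeasurableM => //; apply: cmeasurable_real; exact: measurable_indic.
have mG2 : cmeasurable G2.
  by apply: cmeasurableM => //; apply: cmeasurable_real; exact: measurable_indic.
have DE x : h x * g x = G1 x + G2 x.
  rewrite /G1 /G2 !indicE; have [hs|hs] := leP (normc (h x)) s.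
    rewrite (mem_set (hs : D x)) memNset ?mul0r ?add0r ?mul1r//.
    by rewrite /E /= ltNge hs.
  rewrite (mem_set (hs : E x)) memNset ?mul0r ?addr0 ?mul1r//.
  by rewrite /D /= leNgt hs.
have LG2 : L2 G2.
  have [msg sgo] := L2Z s%:C Lg.
  split=> //; apply: le_lt_trans sgo; apply: cnorm2_le_ae => //.
  apply: aeW => x; rewrite /G2 !Normc.normcM !normc_real (ger0_norm (ltW s0)).
  rewrite indicE; case: (boolP (x \in D)) => [|_]; last first.
    by rewrite normr0 mul0r mulr_ge0 ?normc_ge0// ltW.
  by rewrite inE normr1 mul1r => Dx; rewrite ler_wpM2r ?normc_ge0.
(* Cauchy-Schwarz in the weighted form [y * z <= y ^+ 2 / (2 * delta) + delta / 2 * z ^+ 2]. The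
   weight [delta = eta * lambda] balances the two terms, as the squares integrate to at most
   [delta ^+ 2] and 1. *)
have intG1 : (\int[mu]_x (normc (G1 x))%:E <= (eta * lambda)%:E)%E.
  have d0 : 0 < eta * lambda by rewrite mulr_gt0.
  have := tail _ l0; rewrite -/s -/E; set delta := eta * lambda in d0 *.
  pose I1 := (\int[mu]_x (\1_E x * normc (h x) ^+ 2)%:E)%E.
  rewrite -/I1 => tailI1.
  have mI1 : measurable_fun setT (fun x => (\1_E x * normc (h x) ^+ 2)%:E).
    apply/measurable_EFinP/measurable_funM; last exact: measurable_funX.
    exact: measurable_indic.
  have I1_0 x : setT x -> (0 <= (\1_E x * normc (h x) ^+ 2)%:E)%E.
    by move=> _; rewrite lee_fin mulr_ge0 ?sqr_ge0.
  have mg2 := measurable_normc_sqr mg.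
  have g2_0 x : setT x -> (0 <= (normc (g x) ^+ 2)%:E)%E.
    by move=> _; rewrite lee_fin sqr_ge0.
  have dV : 0 <= (2 * delta)^-1 by rewrite invr_ge0 mulr_ge0// ltW.
  have d2 : 0 <= delta / 2 by rewrite divr_ge0// ltW.
  apply: (@le_trans _ _
    ((2 * delta)^-1%:E * I1 + (delta / 2)%:E * energy mu g)%E); last first.
    apply: (@le_trans _ _
      ((2 * delta)^-1%:E * (delta ^+ 2)%:E + (delta / 2)%:E * 1)%E).
      by apply: leeD; rewrite lee_wpmul2l ?lee_fin.
    rewrite mule1 -EFinM -EFinD lee_fin le_eqVlt; apply/orP; left.
    by apply/eqP; field; rewrite gt_eqF.
  rewrite /energy /I1 -!ge0_integralZl// -ge0_integralD//; last 4 first.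
  - by move=> x Tx; rewrite mule_ge0// I1_0.
  - exact: measurable_funeM.
  - by move=> x Tx; rewrite mule_ge0// g2_0.
  - exact: measurable_funeM.
  apply: ge0_le_integral => //.
  - by move=> x _; rewrite lee_fin normc_ge0.
  - exact/measurable_EFinP/measurable_normc.
  - by apply: emeasurable_funD; exact: measurable_funeM.
  move=> x _; rewrite -!EFinM -EFinD lee_fin /G1 !Normc.normcM normc_real.
  have -> : \1_E x * normc (h x) ^+ 2 = (\1_E x * normc (h x)) ^+ 2 :> R.
    by rewrite indicE; case: (x \in E); rewrite ?mulr1n ?mulr0n; ring.
  rewrite ger0_norm// mulrA; set y := \1_E x * _; set z := normc (g x).
  rewrite -subr_ge0.
  have -> : (2 * delta)^-1 * y ^+ 2 + delta / 2 * z ^+ 2 - y * z =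
    (2 * delta)^-1 * (y - delta * z) ^+ 2 by field; rewrite gt_eqF.
  by rewrite mulr_ge0 ?sqr_ge0.
have LG1 : L1 G1.
  by apply/inL1P; split=> //; apply: le_lt_trans intG1 _; rewrite ltry.
have [u [Lu uE wu]] := inverse_image_split ww LG1 LG2 DE.
exists u; split=> //; apply: filterS wu => x /le_trans; apply.
have I0 : 0 <= \int[mu]_xi normc (G1 xi).
  by apply: Rintegral_ge0 => y _; exact: normc_ge0.
have I1 : \int[mu]_xi normc (G1 xi) <= eta * lambda.
  rewrite -lee_fin fineK// ge0_fin_numE.
    by apply: le_lt_trans intG1 _; rewrite ltry.
  by apply: integral_ge0 => y _; rewrite lee_fin normc_ge0.
apply: (@le_trans _ _ (a * (eta * lambda))).
  rewrite /a -mulrA ler_wpM2l ?normc_ge0//.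
  apply: (@le_trans _ _ (`|M| * \int[mu]_xi normc (G1 xi))).
    by rewrite ler_wpM2r// ler_norm.
  by rewrite ler_wpM2l.
rewrite mulrA (mulrC lambda) ler_wpM2r ?(ltW l0)// /eta invfM mulrCA.
rewrite ger_pMr ?invr_gt0//.
by rewrite ler_pdivrMr ?mul1r ?lerDl// ltr_wpDl.
Qed.

End multiplier.

(** * The nonlinearity *)

Section power_nonlinearity.
Context {R : realType}.
Implicit Types a b x y : R.

(** Includes [a = 0], where both sides vanish because the exponent [r + 1] is nonzero. *)
Lemma powRD1 a (r : R) : 0 <= a -> r + 1 != 0 -> a `^ (r + 1) = a `^ r * a.
Proof.
move=> a0 r1; have [->|an0] := eqVneq a 0.
  by rewrite mulr0 powR0.
by rewrite powRD ?an0 ?implybT// powRr1.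
Qed.

(* Young's inequality for [a `^ (p - 1) * b] is the tangent inequality of the
   convex function [a `^ p]. *)
Lemma powRB_le p a b : 1 < p -> 0 <= a -> 0 <= b ->
  a `^ p - b `^ p <= p * a `^ (p - 1) * (a - b).
Proof.
move=> p1 a0 b0; have p0 : 0 < p := lt_trans ltr01 p1.
have p10 : 0 < p - 1 by rewrite subr_gt0.
have aE : a `^ p = a `^ (p - 1) * a.
  by rewrite -powRD1// subrK// gt_eqF.
have := @conjugate_powR _ (a `^ (p - 1)) b (p / (p - 1)) p (powR_ge0 _ _) b0.
rewrite divr_gt0// => /(_ isT p0); rewrite -powRrM.
rewrite (_ : (p - 1) * (p / (p - 1)) = p); last by field; rewrite gt_eqF.
move=> H; have {}H : a `^ (p - 1) * b <= a `^ p / (p / (p - 1)) + b `^ p / p.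
  by apply: H; field; rewrite !gt_eqF.
have {}H : p * (a `^ (p - 1) * b) <= (p - 1) * a `^ p + b `^ p.
  rewrite -(ler_pM2l p0) in H; apply: le_trans H _.
  rewrite le_eqVlt; apply/orP; left; apply/eqP; field.
  by rewrite !gt_eqF.
rewrite mulrBr -[_ * a]mulrA -aE -mulrA.
by move: H; set u := _ * b; nra.
Qed.

Lemma powRB_norm_le p a b m : 1 < p -> 0 <= a <= m -> 0 <= b <= m ->
  `|a `^ p - b `^ p| <= p * m `^ (p - 1) * `|a - b|.
Proof.
move=> p1; wlog ab : a b / b <= a.
  move=> H am bm; have [/H|/ltW/H] := leP b a; first exact.
  by rewrite distrC (distrC a); apply.
move=> /andP[a0 am] /andP[b0 bm]; have p0 : 0 < p := lt_trans ltr01 p1.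
have m0 := le_trans a0 am.
rewrite ger0_norm ?subr_ge0; last by rewrite ge0_ler_powR ?nnegrE ?(ltW p0).
rewrite ger0_norm ?subr_ge0//; apply: le_trans (powRB_le p1 a0 b0) _.
rewrite ler_wpM2r ?subr_ge0// ler_wpM2l ?(ltW p0)//.
by rewrite ge0_ler_powR ?nnegrE// subr_ge0 ltW.
Qed.

(** A pointwise inequality in the role of Hölder. With [m] the largest of [a], [b] and [d / e], the
    difference of the powers is at most p m^(p-1) d <= p e m^p, and m^(2p) is at most the sum of the
    three powers. Later [e] bounds the norm of [f - g] and [d] is the modulus of [B (f - g)], so the
    integral of the last term is bounded independently of [e]. *)
Lemma sqr_powRB_le p a b d e : 1 < p -> 0 <= a -> 0 <= b -> 0 < e ->
  `|a - b| <= d -> (a `^ p - b `^ p) ^+ 2 <=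
  (p * e) ^+ 2 * (a `^ (2 * p) + b `^ (2 * p) + (d / e) `^ (2 * p)).
Proof.
move=> p1 a0 b0 e0 abd; have p0 : 0 < p := lt_trans ltr01 p1.
have p10 : 0 < p - 1 by rewrite subr_gt0.
have d0 : 0 <= d := le_trans (normr_ge0 _) abd.
have f0 : 0 <= d / e by rewrite divr_ge0// ltW.
pose m := Num.max (Num.max a b) (d / e).
have am : a <= m by rewrite !le_max lexx.
have bm : b <= m by rewrite !le_max lexx orbT.
have fm : d / e <= m by rewrite !le_max lexx orbT.
have m0 := le_trans a0 am.
have H : `|a `^ p - b `^ p| <= p * e * m `^ p.
  apply: le_trans (powRB_norm_le p1 _ _ : _ <= p * m `^ (p - 1) * _) _.
  - by rewrite a0.
  - by rewrite b0.
  have mE : m `^ p = m `^ (p - 1) * m by rewrite -powRD1// subrK// gt_eqF.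
  rewrite mE (_ : p * e * _ = p * m `^ (p - 1) * (e * m)); last by ring.
  rewrite ler_wpM2l ?mulr_ge0 ?powR_ge0 ?(ltW p0)//.
  by apply: le_trans abd _; rewrite mulrC -ler_pdivrMr.
rewrite -real_normK ?num_real//.
apply: (@le_trans _ _ ((p * e * m `^ p) ^+ 2)).
  rewrite ler_pXn2r ?nnegrE//.
  by rewrite !mulr_ge0 ?powR_ge0 ?(ltW p0) ?(ltW e0).
rewrite exprMn ler_wpM2l ?sqr_ge0//.
rewrite -powR_mulrn ?powR_ge0// -powRrM (mulrC p).
have := powR_ge0 a (2 * p); have := powR_ge0 b (2 * p).
have := powR_ge0 (d / e) (2 * p).
rewrite /m; case: (leP (Num.max a b) (d / e)) => _; first lra.
by case: (leP a b) => _; lra.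
Qed.

End power_nonlinearity.

(** * The map taking f to |B f|^p on L^2: boundedness and Lipschitz continuity on balls *)

Section operator_power.
Context d (T : measurableType d) (R : realType).
Variable mu : {measure set T -> \bar R}.
Implicit Types f g : T -> R[i].
Local Notation L1 := (inLp mu 1%:E).
Local Notation L2 := (inLp mu 2%:E).

Variables (B : (T -> R[i]) -> T -> R[i]) (p C : R).
Hypothesis B_linear : linear_on_L2 mu B.
Hypothesis B_meas : forall f, L2 f -> cmeasurable (B f).
Hypothesis p1 : 1 < p.
Hypothesis C0 : 0 <= C.
Hypothesis B_unit : forall f, L2 f -> (energy mu f <= 1)%E ->
  (\int[mu]_x (normc (B f x) `^ (2 * p))%:E <= C%:E)%E.

Lemma operator_zero : B (fun=> 0) = (fun=> 0) %[ae mu].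
Proof.
have := B_linear 1 (L2_0 mu) (L2_0 mu).
rewrite (_ : (fun x : T => 1 * 0 + 0) = (fun=> 0 : R[i])); last first.
  by apply/funext => x; rewrite mulr0 addr0.
apply: filterS => x /(_ I) + _; rewrite mul1r => /eqP.
by rewrite -subr_eq0 opprD addrA subrr add0r oppr_eq0 => /eqP.
Qed.

Lemma measurable_normc_powR f (r : R) : cmeasurable f ->
  measurable_fun setT (fun x => (normc (f x) `^ r)%:E).
Proof.
move=> mf; apply/measurable_EFinP.
exact: (measurableT_comp (measurable_powR _) (measurable_normc mf)).
Qed.

Lemma operator_bound f (r : R) : 0 < r -> L2 f ->
  (cnorm mu 2%:E f <= r%:E)%E ->
  (\int[mu]_x (normc (B f x) `^ (2 * p))%:E <= (C * r `^ (2 * p))%:E)%E.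
Proof.
move=> r0 Lf fr; pose f' x := (r^-1)%:C * f x.
have Lf' : L2 f' by exact: L2Z.
have mBf := B_meas Lf; have mBf' := B_meas Lf'.
have f'1 : (energy mu f' <= 1)%E.
  suff : (energy mu f' <= (1 ^+ 2 : R)%:E)%E by rewrite expr1n.
  rewrite -cnorm2_le//.
  have [mf _] := Lf.
  have := cnorm2Z (r^-1)%:C mf (ltW r0) fr.
  by rewrite normc_real ger0_norm ?invr_ge0 ?(ltW r0)// mulVf// gt_eqF.
(* [linear_on_L2] speaks of [c * f + g], so homogeneity is its case [g = 0], together with
   [operator_zero]. *)
have fE : f = (fun x => r%:C * f' x + 0).
  apply/funext => x; rewrite addr0 /f' mulrA -rmorphM mulfV ?mul1r//.
  by rewrite gt_eqF.
have BfE : {ae mu, forall x, normc (B f x) = r * normc (B f' x)}.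
  have := B_linear r%:C Lf' (L2_0 mu); rewrite -fE.
  move: operator_zero; apply: filterS2 => x /(_ I) B0 /(_ I) ->.
  by rewrite B0 addr0 Normc.normcM normc_real gtr0_norm.
apply: (@le_trans _ _
    (\int[mu]_x ((r `^ (2 * p))%:E * (normc (B f' x) `^ (2 * p))%:E))%E).
  apply: ae_ge0_le_integral => //.
  - by move=> x _; rewrite lee_fin powR_ge0.
  - exact: measurable_normc_powR.
  - by move=> x _; rewrite -EFinM lee_fin mulr_ge0 ?powR_ge0.
  - by apply: measurable_funeM; exact: measurable_normc_powR.
  - by apply: filterS BfE => x -> _; rewrite -EFinM powRM ?normc_ge0// ltW.
rewrite ge0_integralZl//; last 3 first.
- exact: measurable_normc_powR.
- by move=> x _; rewrite lee_fin powR_ge0.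
- by rewrite lee_fin powR_ge0.
by rewrite (mulrC C) EFinM lee_wpmul2l ?lee_fin ?powR_ge0 ?B_unit.
Qed.

Definition operator_power f : T -> R[i] := fun x => (normc (B f x) `^ p)%:C.

Lemma cmeasurable_operator_power f : L2 f -> cmeasurable (operator_power f).
Proof.
move=> Lf; apply: cmeasurable_real; apply/measurable_EFinP.
exact: (measurable_normc_powR _ (B_meas Lf)).
Qed.

Lemma energy_operator_power f :
  energy mu (operator_power f) = (\int[mu]_x (normc (B f x) `^ (2 * p))%:E)%E.
Proof.
apply: eq_integral => x _; rewrite normc_real ger0_norm ?powR_ge0//.
by rewrite -powR_mulrn ?powR_ge0// -powRrM mulrC.
Qed.

Lemma operator_power_bound f (r : R) : 0 < r -> L2 f ->
  (cnorm mu 2%:E f <= r%:E)%E ->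
  (cnorm mu 2%:E (operator_power f) <= (Num.sqrt (C * r `^ (2 * p)))%:E)%E.
Proof.
move=> r0 Lf fr; rewrite cnorm2_le ?sqrtr_ge0// sqr_sqrtr ?mulr_ge0 ?powR_ge0//.
by rewrite energy_operator_power operator_bound.
Qed.

Lemma operator_power_L2 f : L2 f -> L2 (operator_power f).
Proof.
move=> Lf; have [r r0 fr] := L2_fin Lf.
have r10 : 0 < r + 1 by rewrite ltr_wpDl.
apply: L2_le (cmeasurable_operator_power Lf) (operator_power_bound r10 Lf _).
by rewrite fr lee_fin lerDl.
Qed.

(** Integration of [sqr_powRB_le] with [d = normc (B f x - B g x)]: the first two terms contribute C
    r^(2p) each and the third, scaled by [e], contributes [C]. *)
Lemma operator_power_lip_gt0 f g (r e : R) : 0 < r -> 0 < e -> L2 f -> L2 g ->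
  (cnorm mu 2%:E f <= r%:E)%E -> (cnorm mu 2%:E g <= r%:E)%E ->
  (cnorm mu 2%:E (fun x => f x - g x)%R <= e%:E)%E ->
  (cnorm mu 2%:E (fun x => operator_power f x - operator_power g x)%R <=
    (p * Num.sqrt (C * (2 * r `^ (2 * p) + 1)) * e)%:E)%E.
Proof.
move=> r0 e0 Lf Lg fr gr fg; have p0 : 0 < p := lt_trans ltr01 p1.
pose diff x := f x - g x; have Lfg : L2 diff := L2B Lf Lg.
have mBf := B_meas Lf; have mBg := B_meas Lg.
have mBfg := B_meas Lfg.
have CC : 0 <= C * (2 * r `^ (2 * p) + 1).
  by rewrite mulr_ge0// addr_ge0// mulr_ge0// powR_ge0.
rewrite cnorm2_le; last by rewrite !mulr_ge0 ?sqrtr_ge0 ?(ltW p0) ?(ltW e0).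
have BE : {ae mu, forall x,
    B diff x = B f x - B g x}.
  have := B_linear (-1) Lg Lf.
  rewrite (_ : (fun x => -1 * g x + f x) = diff); last first.
    by apply/funext => x; rewrite /diff mulN1r addrC.
  by apply: filterS => x /(_ I) ->; rewrite mulN1r addrC.
pose v x := (((p * e) ^+ 2)%:E * ((normc (B f x) `^ (2 * p))%:E +
  (normc (B g x) `^ (2 * p))%:E + (e `^ (- (2 * p)))%:E *
  (normc (B diff x) `^ (2 * p))%:E))%E.
have v1 x : (0 <= (normc (B f x) `^ (2 * p))%:E + (normc (B g x) `^ (2 * p))%:E)%E.
  by rewrite -EFinD lee_fin addr_ge0 ?powR_ge0.
have v2 x : (0 <= (e `^ (- (2 * p)))%:E *
    (normc (B diff x) `^ (2 * p))%:E)%E.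
  by rewrite -EFinM lee_fin mulr_ge0 ?powR_ge0.
have mv2 : measurable_fun setT (fun x => (e `^ (- (2 * p)))%:E *
    (normc (B diff x) `^ (2 * p))%:E)%E.
  by apply: measurable_funeM; exact: measurable_normc_powR.
have mv1 : measurable_fun setT (fun x => (normc (B f x) `^ (2 * p))%:E +
    (normc (B g x) `^ (2 * p))%:E)%E.
  by apply: emeasurable_funD; exact: measurable_normc_powR.
have pe0 : (0 <= ((p * e) ^+ 2)%:E :> \bar R)%E by rewrite lee_fin sqr_ge0.
apply: (@le_trans _ _ (\int[mu]_x v x)%E).
  apply: ae_ge0_le_integral => //.
  - by move=> x _; rewrite lee_fin sqr_ge0.
  - by apply/measurable_normc_sqr/cmeasurableB; exact: cmeasurable_operator_power.
  - by move=> x _; rewrite /v mule_ge0// adde_ge0.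
  - by apply: measurable_funeM; exact: emeasurable_funD.
  apply: filterS BE => x Bx _.
  rewrite /operator_power -rmorphB normc_real /v -!EFinM lee_fin.
  rewrite real_normK ?num_real//.
  have := sqr_powRB_le p1 (normc_ge0 (B f x)) (normc_ge0 (B g x)) e0
    (ler_dist_normc (B f x) (B g x)).
  rewrite -Bx powRM ?normc_ge0 ?invr_ge0 ?(ltW e0)//.
  by rewrite -(powR_inv1 (ltW e0)) -powRrM mulN1r (mulrC (e `^ _)).
rewrite /v ge0_integralZl//; last 2 first.
- exact: emeasurable_funD.
- by move=> x _; rewrite adde_ge0.
rewrite ge0_integralD// ge0_integralD//; last 4 first.
- by move=> x _; rewrite lee_fin powR_ge0.
- exact: measurable_normc_powR.
- by move=> x _; rewrite lee_fin powR_ge0.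
- exact: measurable_normc_powR.
rewrite ge0_integralZl//; last 3 first.
- exact: measurable_normc_powR.
- by move=> x _; rewrite lee_fin powR_ge0.
- by rewrite lee_fin powR_ge0.
apply: (@le_trans _ _ (((p * e) ^+ 2)%:E * ((C * r `^ (2 * p))%:E +
    (C * r `^ (2 * p))%:E + (e `^ (- (2 * p)))%:E * (C * e `^ (2 * p))%:E))%E).
  rewrite lee_wpmul2l//; apply: leeD; first by apply: leeD; exact: operator_bound.
  by rewrite lee_wpmul2l ?lee_fin ?powR_ge0//; exact: operator_bound.
rewrite -!EFinM lee_fin le_eqVlt; apply/orP; left; apply/eqP.
rewrite mulrCA powRN mulVf ?gt_eqF ?powR_gt0// mulr1.
rewrite [RHS](_ : _ = (p * e) ^+ 2 * Num.sqrt (C * (2 * r `^ (2 * p) + 1)) ^+ 2).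
  by rewrite sqr_sqrtr//; ring.
by ring.
Qed.

(** The case [e = 0], excluded so far by the division by [e], is reached by enlarging [e] to
    [e + eps / (L + 1)]. *)
Lemma operator_power_lip f g (r e : R) : 0 < r -> 0 <= e -> L2 f -> L2 g ->
  (cnorm mu 2%:E f <= r%:E)%E -> (cnorm mu 2%:E g <= r%:E)%E ->
  (cnorm mu 2%:E (fun x => f x - g x)%R <= e%:E)%E ->
  (cnorm mu 2%:E (fun x => operator_power f x - operator_power g x)%R <=
    (p * Num.sqrt (C * (2 * r `^ (2 * p) + 1)) * e)%:E)%E.
Proof.
move=> r0 e0 Lf Lg fr gr fg; set L := p * _.
have L0 : 0 <= L by rewrite mulr_ge0 ?sqrtr_ge0// ltW// (lt_trans ltr01).
apply/lee_addgt0Pr => eps eps0; rewrite -EFinD.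
pose e' := e + eps / (L + 1).
have L1 : 0 < L + 1 by rewrite ltr_wpDl.
have ep : 0 < eps / (L + 1) by rewrite divr_gt0.
have e'0 : 0 < e' by rewrite /e' ltr_wpDl.
apply: le_trans (operator_power_lip_gt0 r0 e'0 Lf Lg fr gr _) _.
  by apply: le_trans fg _; rewrite lee_fin lerDl ltW.
rewrite -/L lee_fin /e' mulrDr lerD2l mulrCA ger_pMr//.
by rewrite ler_pdivrMr ?mul1r ?lerDl.
Qed.

End operator_power.

(** * Completeness of L2 *)

Section completeness.
Context d (T : measurableType d) (R : realType).
Variable mu : {measure set T -> \bar R}.
Implicit Types f g : T -> R[i].
Local Notation L2 := (inLp mu 2%:E).

Lemma is_cvg_of_bounded_variation (x v : nat -> R) (C : R) :
  (forall n, `|x n.+1 - x n| <= v n) -> (forall n, \sum_(i < n) v i <= C) ->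
  cvgn x.
Proof.
move=> xv vC; pose e n := x n.+1 - x n.
have xE : x = (fun n => x 0%N + series e n).
  apply/funext => n; rewrite /series /= /e.
  by rewrite (telescope_sumr _ (leq0n n)) addrCA subrr addr0.
have ce : cvgn (series e).
  apply: normed_cvg; apply: nondecreasing_is_cvgn.
    by apply/nondecreasing_series => n _ _; exact: normr_ge0.
  exists C => _ [n _ <-]; apply: le_trans (vC n).
  by rewrite /= seriesEord /=; apply: ler_sum => i _; exact: xv.
by rewrite xE; apply: is_cvgD => //; exact: is_cvg_cst.
Qed.

Lemma sum_geometric_half n : \sum_(i < n) (2 ^- i : R) <= 2.
Proof.
suff -> : \sum_(i < n) (2 ^- i : R) = 2 - 2 * 2 ^- n.
  by rewrite gerBl mulr_ge0// invr_ge0 exprn_ge0.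
elim: n => [|n IH]; first by rewrite big_ord0 expr0 invr1 mulr1 subrr.
rewrite big_ord_recr /= IH exprS invfM; field.
by rewrite gt_eqF ?exprn_gt0.
Qed.

Lemma cnorm2_telescope (f : nat -> T -> R[i]) (D : R) : 0 <= D ->
  (forall n, cmeasurable (f n)) ->
  (forall n, (cnorm mu 2%:E (fun x => f n.+1 x - f n x)%R <= (D / 2 ^+ n)%:E)%E) ->
  forall n m, (cnorm mu 2%:E (fun x => f n x - f (n + m)%N x)%R <=
    (2 * D / 2 ^+ n)%:E)%E.
Proof.
move=> D0 mf fD n m.
suff H : (cnorm mu 2%:E (fun x => f n x - f (n + m)%N x)%R <=
    (D / 2 ^+ n * \sum_(i < m) 2 ^- i)%:E)%E.
  apply: le_trans H _; rewrite lee_fin [leRHS](_ : _ = D / 2 ^+ n * 2).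
    by rewrite ler_wpM2l ?sum_geometric_half// divr_ge0// exprn_ge0.
  by ring.
elim: m => [|m IH].
  rewrite big_ord0 mulr0 addn0.
  under [X in cnorm _ _ X]eq_fun do rewrite subrr.
  by rewrite cnorm2_0.
rewrite big_ord_recr /= mulrDr addnS.
rewrite (_ : (fun x => _) = (fun x => (f n x - f (n + m)%N x) -
  (f (n + m).+1 x - f (n + m)%N x))); last by apply/funext => x; ring.
apply: (le_trans (cnorm2B _ _ _)); [exact: cmeasurableB|exact: cmeasurableB|].
rewrite [leRHS]EFinD; apply: leeD => //; apply: le_trans (fD _) _.
by rewrite lee_fin exprD invfM mulrA.
Qed.

(** Integrability of [S] gives pointwise convergence almost everywhere; Fatou then carries the
    telescoped bound over to the limit with the same constant. *)
Lemma L2_complete (f : nat -> T -> R[i]) (D : R) : 0 <= D ->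
  (forall n, L2 (f n)) ->
  (forall n, (cnorm mu 2%:E (fun x => f n.+1 x - f n x)%R <= (D / 2 ^+ n)%:E)%E) ->
  exists2 F, L2 F & forall n,
    (cnorm mu 2%:E (fun x => f n x - F x)%R <= (2 * D / 2 ^+ n)%:E)%E.
Proof.
move=> D0 Lf fD; have mf n : cmeasurable (f n) by case: (Lf n).
pose e n x := f n.+1 x - f n x.
have me n : cmeasurable (e n) by exact: cmeasurableB.
have p2 n : 0 < (2 : R) ^+ n by rewrite exprn_gt0.
(* The energies are at most [D ^+ 2 / 4 ^+ n], so even with the weight [2 ^+ n] a geometric series
   of ratio 1/2 remains. *)
pose u n x : R := 2 ^+ n * normc (e n x) ^+ 2.
have u0 n x : 0 <= u n x by rewrite /u mulr_ge0 ?sqr_ge0// ltW.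
have mu_ n : measurable_fun setT (fun x => (u n x)%:E).
  by apply/measurable_EFinP/measurable_funM => //;
    exact/measurable_funX/measurable_normc.
pose S x := (\sum_(0 <= n <oo) (u n x)%:E)%E.
have S0 x : (0 <= S x)%E by apply: nneseries_ge0 => n _ _; rewrite lee_fin.
have mS : measurable_fun setT S.
  by apply: ge0_emeasurable_sum => // n x _ _; rewrite lee_fin.
have iS : (\int[mu]_x S x < +oo)%E.
  rewrite integral_nneseries//; last by move=> n x _; rewrite lee_fin.
  apply: (@le_lt_trans _ _ (D ^+ 2 * 2)%:E); last by rewrite ltry.
  apply: (@le_trans _ _ (\sum_(0 <= n <oo) (D ^+ 2 * 2 ^- n)%:E)%E).
    apply: lee_nneseries => [n _ _|n _].
      by apply: integral_ge0 => x _; rewrite lee_fin.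
    have -> : (\int[mu]_x (u n x)%:E = (2 ^+ n)%:E * energy mu (e n))%E.
      rewrite -ge0_integralZl//=.
      - exact: measurable_normc_sqr.
      - by move=> x _; rewrite lee_fin sqr_ge0.
    have := fD n; rewrite cnorm2_le ?divr_ge0 ?(ltW (p2 n))// => en.
    apply: (@le_trans _ _ ((2 ^+ n)%:E * ((D / 2 ^+ n) ^+ 2)%:E)%E).
      by rewrite lee_wpmul2l ?lee_fin ?(ltW (p2 n)).
    rewrite -EFinM lee_fin le_eqVlt; apply/orP; left; apply/eqP; field.
    by rewrite gt_eqF.
  apply: nneseries_le_bound => [n|n].
    by rewrite mulr_ge0 ?sqr_ge0// invr_ge0 ltW.
  by rewrite -mulr_sumr ler_wpM2l ?sqr_ge0// sum_geometric_half.
pose A := [set x | (S x < +oo)%E].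
have mA : measurable A.
  by rewrite -[A]setTI; exact: emeasurable_fun_infty_o.
have aeA : {ae mu, forall x, A x}.
  have : mu.-integrable setT S.
    by apply/integrableP; split=> //; under eq_integral do rewrite gee0_abs//.
  move=> /integrable_ae => /(_ measurableT); apply: filterS => x /(_ I).
  by rewrite ge0_fin_numE.
have cvgA x : A x -> cvgn (fun n => complex.Re (f n x)) /\
    cvgn (fun n => complex.Im (f n x)).
  move=> Ax; have Sf : S x \is a fin_num by rewrite ge0_fin_numE.
  have bnd n : \sum_(i < n) (2 ^- i + u i x) <= 2 + fine (S x).
    rewrite big_split lerD ?sum_geometric_half// -lee_fin fineK//.
    rewrite -sumEFin -(big_mkord xpredT (fun i => (u i x)%:E)).
    by apply: nneseries_lim_ge => i _ _; rewrite lee_fin.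
  (* Arithmetic-geometric mean: summability of the squares with growing weights controls the
     increments themselves. *)
  have edom i : normc (e i x) <= 2 ^- i + u i x.
    rewrite /u; set y := normc _; have y0 : 0 <= y by exact: normc_ge0.
    rewrite -subr_ge0.
    have -> : 2 ^- i + 2 ^+ i * y ^+ 2 - y =
        2 ^- i * ((1 - 2 ^+ i * y) ^+ 2 + 2 ^+ i * y).
      by field; rewrite gt_eqF.
    by rewrite mulr_ge0 ?invr_ge0 ?(ltW (p2 i))// addr_ge0 ?sqr_ge0// mulr_ge0// ltW.
  split; apply: (is_cvg_of_bounded_variation _ bnd) => i.
    by apply: le_trans (edom i); rewrite -complexReN -complexReD Re_le_normc.
  by apply: le_trans (edom i); rewrite -complexImN -complexImD Im_le_normc.
(* [F] is 0 off [A], so that the truncated sequence [fA] converges to it at every point and [F] is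
   measurable. *)
pose F x : R[i] := (\1_A x)%:C *
  (limn (fun n => complex.Re (f n x)) +i* limn (fun n => complex.Im (f n x))).
pose fA n x : R[i] := (\1_A x)%:C * f n x.
have mfA n : cmeasurable (fA n).
  by apply: cmeasurableM => //; apply: cmeasurable_real; exact: measurable_indic.
have ReF x : complex.Re (fA n x) @[n --> \oo] --> complex.Re (F x).
  rewrite /fA /F indicE; case: (boolP (x \in A)) => [|_].
    rewrite inE => Ax; rewrite !mul1r /=; under eq_fun do rewrite mul1r.
    exact: (cvgA x Ax).1.
  rewrite !mul0r; under eq_fun do rewrite mul0r.
  exact: cvg_cst.
have ImF x : complex.Im (fA n x) @[n --> \oo] --> complex.Im (F x).
  rewrite /fA /F indicE; case: (boolP (x \in A)) => [|_].
    rewrite inE => Ax; rewrite !mul1r /=; under eq_fun do rewrite mul1r.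
    exact: (cvgA x Ax).2.
  rewrite !mul0r; under eq_fun do rewrite mul0r.
  exact: cvg_cst.
have mF : cmeasurable F.
  split; [apply: (measurable_fun_cvg (h := fun n x => complex.Re (fA n x)))|
    apply: (measurable_fun_cvg (h := fun n x => complex.Im (fA n x)))] => //.
  - by move=> n; case: (mfA n).
  - by move=> n; case: (mfA n).
have FE n : (cnorm mu 2%:E (fun x => f n x - F x)%R <= (2 * D / 2 ^+ n)%:E)%E.
  have -> : cnorm mu 2%:E (fun x => f n x - F x) =
      cnorm mu 2%:E (fun x => fA n x - F x).
    apply: cnorm2_ae_eq; [exact: cmeasurableB..|].
    by apply: filterS aeA => x Ax _; rewrite /fA indicE mem_set// mul1r.
  rewrite cnorm2_le; last by rewrite divr_ge0 ?(ltW (p2 n))// mulr_ge0.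
  pose v m x := (normc (fA n x - fA (n + m)%N x) ^+ 2)%:E.
  have mv m : measurable_fun setT (v m).
    by apply: measurable_normc_sqr; exact: cmeasurableB.
  have v0 m x : setT x -> (0 <= v m x)%E by move=> _; rewrite lee_fin sqr_ge0.
  have -> : energy mu (fun x => fA n x - F x) =
      (\int[mu]_x limn_einf (v ^~ x))%E.
    apply: eq_integral => x _; apply/esym.
    suff vx : v m x @[m --> \oo] --> (normc (fA n x - F x) ^+ 2)%:E.
      rewrite is_cvg_limn_einfE; first exact: cvg_lim.
      by apply/cvg_ex; eexists; exact: vx.
    rewrite /v; apply: cvg_EFin; first exact: nearW.
    rewrite normc_sqr; under eq_fun do rewrite normc_sqr.
    rewrite !(complexReD, complexImD, complexReN, complexImN).
    under eq_fun do rewrite !(complexReD, complexImD, complexReN, complexImN).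
    have sh (y : nat -> R) (l : R) : y m @[m --> \oo] --> l ->
        y (n + m)%N @[m --> \oo] --> l.
      rewrite -(cvg_shiftn n) => yl; under eq_fun do rewrite addnC.
      exact: yl.
    have := sh _ _ (ReF x); have := sh _ _ (ImF x) => /= Ic Rc.
    by apply: cvgD; apply: cvgM; apply: cvgB => //; exact: cvg_cst.
  apply: le_trans (fatou mu measurableT mv v0) _.
  rewrite limn_einf_lim; apply: lime_le; first exact: is_cvg_einfs.
  apply: nearW => m; apply: ereal_inf_le; exists (\int[mu]_x v m x)%E.
    by exists m => /=.
  rewrite -[leLHS]/(energy mu (fun x => fA n x - fA (n + m)%N x)).
  rewrite -cnorm2_le; last by rewrite divr_ge0 ?(ltW (p2 n))// mulr_ge0.
  apply: le_trans (cnorm2_telescope D0 mf fD n m).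
  apply: cnorm2_le_ae; [exact: cmeasurableB|exact: cmeasurableB|].
  by apply: filterS aeA => x Ax; rewrite /fA indicE mem_set// !mul1r.
exists F => //.
have E : F = (fun x => f 0%N x - (f 0%N x - F x)).
  by apply/funext => x; rewrite opprB addrC subrK.
rewrite E; apply: L2B => //; apply: L2_le (FE 0%N).
exact: cmeasurableB.
Qed.

End completeness.

(** * Step functions of time *)

Import HBNNSimple.

Section euler.
Context d (T : measurableType d) (R : realType).
Variable mu : {measure set T -> \bar R}.
Implicit Types f g : T -> R[i].
Local Notation L2 := (inLp mu 2%:E).
Local Notation leb := (@lebesgue_measure R).

Definition cnorm_le f (r : R) : Prop := (cnorm mu 2%:E f <= r%:E)%E.

Lemma cnorm_leD f g (r s : R) : L2 f -> L2 g -> cnorm_le f r -> cnorm_le g s ->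
  cnorm_le (fun x => f x + g x) (r + s).
Proof.
move=> [mf _] [mg _] fr gs; rewrite /cnorm_le; apply: le_trans (cnorm2D mu mf mg) _.
by rewrite [leRHS]EFinD leeD.
Qed.

Lemma cnorm_leB f g (r s : R) : L2 f -> L2 g -> cnorm_le f r -> cnorm_le g s ->
  cnorm_le (fun x => f x - g x) (r + s).
Proof.
move=> [mf _] [mg _] fr gs; rewrite /cnorm_le; apply: le_trans (cnorm2B mu mf mg) _.
by rewrite [leRHS]EFinD leeD.
Qed.

Lemma cnorm_leZ f (r z : R) : L2 f -> 0 <= r -> 0 <= z -> cnorm_le f r ->
  cnorm_le (fun x => z%:C * f x) (z * r).
Proof.
move=> [mf _] r0 z0 fr; have := cnorm2Z z%:C mf r0 fr.
by rewrite normc_real ger0_norm.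
Qed.

Lemma cnorm_le_trans f (r s : R) : r <= s -> cnorm_le f r -> cnorm_le f s.
Proof. by move=> rs fr; rewrite /cnorm_le (le_trans fr)// lee_fin. Qed.

Lemma cvge0_geometric (a : nat -> \bar R) (C : R) : (forall n, 0 <= a n)%E ->
  (forall n, a n <= (C / 2 ^+ n)%:E)%E -> a n @[n --> \oo] --> 0%E.
Proof.
move=> a0 aC; apply: (@squeeze_cvge _ _ _ _ (cst 0%E) _ (fun n => (C / 2 ^+ n)%:E)).
- by apply: nearW => n; rewrite a0 aC.
- exact: cvg_cst.
- apply: cvg_EFin; first exact: nearW.
  rewrite -(mulr0 C); apply: cvgMr.
  under eq_fun do rewrite -exprVn.
  by apply: cvg_expr; rewrite ger0_norm ?invr_ge0// invf_lt1// ltr1n.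
Qed.

(** [a] need not be measurable: the integral of a nonnegative function is a supremum over the simple
    functions below it, and each of these is at most [C] on [D] and 0 elsewhere. The use is for an
    L^2 distance as a function of time. *)
Lemma integral_le_cst (D : set R) (a : R -> \bar R) (C : R) : measurable D ->
  0 <= C -> (forall t, D t -> (0 <= a t <= C%:E)%E) ->
  (\int[leb]_(t in D) a t <= C%:E * leb D)%E.
Proof.
move=> mD C0 aC.
rewrite [leLHS]integral_mkcond [leLHS]ge0_integralTE; last first.
  by move=> t; rewrite /patch; case: ifPn => //; rewrite inE => /aC /andP[].
apply: ge_ereal_sup => _ [h hle <-].
rewrite -integralT_nnsfun -integral_cst// [leRHS]integral_mkcond.
apply: ge0_le_integral => //.
- by move=> x _; rewrite lee_fin; exact: fun_ge0.
- exact/measurable_EFinP.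
- by apply/(measurable_restrictT _ mD); exact: measurable_cst.
move=> x _; apply: le_trans (hle x) _; rewrite /patch; case: ifPn => // xD.
by rewrite inE in xD; case/andP: (aC x xD).
Qed.

(** Allows both conventions at the left end: the meet of [[a, b[] with []0, t[], if nonempty,
    contains [a] except when [a = 0]. *)
Lemma lebesgue_measure_between (a c : R) (X : set R) : a <= c -> measurable X ->
  `]a, c[ `<=` X -> X `<=` `[a, c[ -> fine (leb X) = c - a.
Proof.
move=> ac mX aX Xa.
have itvE b : leb [set` Interval (BSide b a) (BLeft c)] = (c - a)%:E.
  rewrite lebesgue_measure_itv /= lte_fin; case: ltP => // ca.
  by rewrite (le_anti (introT andP (conj ac ca))) subrr.
suff -> : leb X = (c - a)%:E by [].
apply/eqP; rewrite eq_le; apply/andP; split.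
  by rewrite -(itvE true); apply: le_measure; rewrite ?inE.
by rewrite -(itvE false); apply: le_measure; rewrite ?inE.
Qed.

Lemma lebesgue_measure_meet (a b t : R) : 0 <= a -> a <= b ->
  fine (leb (`[a, b[ `&` `]0, t[)) =
  if b <= t then b - a else if a <= t then t - a else 0.
Proof.
move=> a0 ab; have mX : measurable (`[a, b[ `&` `]0, t[).
  by apply: measurableI; exact: measurable_itv.
case: ifPn => [bt|]; last rewrite -ltNge => tb.
  apply: lebesgue_measure_between => //.
  move=> x /=; rewrite !in_itv /= => /andP[ax xb].
  by rewrite (ltW ax) xb (le_lt_trans a0 ax) (lt_le_trans xb bt); split.
case: ifPn => [at_|]; last rewrite -ltNge => ta.
  apply: lebesgue_measure_between => // x /=; rewrite !in_itv /=.
    move=> /andP[ax xt].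
    by rewrite (ltW ax) xt (le_lt_trans a0 ax) (lt_trans xt tb); split.
  by move=> [/andP[-> _] /andP[_ ->]].
rewrite (_ : _ `&` _ = set0) ?measure0//.
apply/seteqP; split=> // x /=; rewrite !in_itv /= => -[/andP[ax _] /andP[_ xt]].
by have := lt_le_trans (lt_trans xt ta) ax; rewrite ltxx.
Qed.

Section steps.
Variables (delta : R) (m : nat) (val : nat -> T -> R[i]).
Hypothesis delta0 : 0 < delta.
Hypothesis Lval : forall j, L2 (val j).

Definition step_itv (j : nat) : set R := `[j%:R * delta, j.+1%:R * delta[%classic.

Definition step_simple : L2simple mu :=
  @MkL2simple _ _ _ mu m (fun j : 'I_m => step_itv j) (fun j => val j)
    (fun j => measurable_itv _) (fun j => Lval j).

Definition step_index (t : R) : nat := Num.truncn (t / delta).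

Lemma step_indexP (t : R) : 0 <= t ->
  (step_index t)%:R * delta <= t < (step_index t).+1%:R * delta.
Proof.
move=> t0; have td : 0 <= t / delta by rewrite divr_ge0// ltW.
have /andP[h1 h2] := truncn_itv td.
by rewrite -ler_pdivlMr// h1 -ltr_pdivrMr.
Qed.

Lemma step_index_lt (t : R) : 0 <= t < m%:R * delta -> (step_index t < m)%N.
Proof.
move=> /andP[t0 tm]; have /andP[h _] := step_indexP t0.
by rewrite -(ltr_nat R) -(ltr_pM2r delta0) (le_lt_trans h).
Qed.

Lemma step_simple_fun (t : R) : 0 <= t < m%:R * delta ->
  simple_fun step_simple t = val (step_index t).
Proof.
move=> tm; have im := step_index_lt tm; have /andP[t0 _] := tm.
have /andP[h1 h2] := step_indexP t0.
apply/funext => x; rewrite /simple_fun /= (bigD1 (Ordinal im))//=.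
rewrite indicE mem_set ?mul1r; last by rewrite /step_itv /= in_itv /= h1.
rewrite big1 ?addr0// => j ji; rewrite indicE memNset ?mul0r//.
rewrite /step_itv /= in_itv /= => /andP[j1 j2].
move/negP: ji; apply; apply/eqP/val_inj => /=; apply/eqP.
rewrite eqn_leq; apply/andP; split.
  by rewrite -ltnS -(ltr_nat R) -(ltr_pM2r delta0) (le_lt_trans j1).
by rewrite -ltnS -(ltr_nat R) -(ltr_pM2r delta0) (le_lt_trans h1).
Qed.

(** Full steps followed by one partial step: the increment of the Euler polygon when [val] lists its
    slopes. *)
Lemma step_simple_integral (t : R) (x : T) : 0 <= t < m%:R * delta ->
  simple_integral `]0, t[ step_simple x =
  \sum_(j < step_index t) delta%:C * val j x +
  (t - (step_index t)%:R * delta)%:C * val (step_index t) x.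
Proof.
move=> tm; have im := step_index_lt tm; have /andP[t0 _] := tm.
have /andP[h1 h2] := step_indexP t0; rewrite /simple_integral /=.
pose w j : R := fine (leb (step_itv j `&` `]0, t[)).
have wE j : w j = if j.+1%:R * delta <= t then delta else
    if j%:R * delta <= t then t - j%:R * delta else 0.
  rewrite /w lebesgue_measure_meet ?mulr_ge0 ?ler_wpM2r ?ler_nat ?(ltW delta0)//.
  by case: ifP => // _; rewrite -mulrBl -natrB// subSnn mul1r.
rewrite -(big_mkord xpredT (fun j => (w j)%:C * val j x)).
rewrite (@big_cat_nat _ _ _ (step_index t).+1)//= big_nat_recr//=.
rewrite [X in _ + X]big1_seq ?addr0; last first.
  move=> j; rewrite mem_index_iota => /andP[_ /andP[ij _]].
  rewrite wE; have tj : t < j%:R * delta.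
    by apply: lt_le_trans h2 _; rewrite ler_pM2r// ler_nat.
  rewrite !ifF ?mul0r//; apply/negbTE; rewrite -ltNge//.
  by apply: lt_le_trans tj _; rewrite ler_pM2r// ler_nat.
congr (_ + _); last by rewrite wE h1 leNgt h2.
rewrite -(big_mkord xpredT (fun j => delta%:C * val j x)) !big_seq.
apply: eq_bigr => j; rewrite mem_index_iota => /andP[_ ji].
rewrite wE ifT//; apply: le_trans h1.
by rewrite ler_pM2r// ler_nat.
Qed.

End steps.

End euler.

(** * The Euler scheme *)

Section euler_scheme.
Context d (T : measurableType d) (R : realType).
Variable mu : {measure set T -> \bar R}.
Implicit Types f g : T -> R[i].
Local Notation L2 := (inLp mu 2%:E).
Local Notation cle := (cnorm_le mu).

Variables (G : (T -> R[i]) -> T -> R[i]) (u0 : T -> R[i]) (Kb L : R).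
Hypothesis Lu0 : L2 u0.
Hypothesis Kb0 : 0 < Kb.
Hypothesis L0 : 0 < L.
Hypothesis G_L2 : forall f, L2 f -> L2 (G f).
Hypothesis G_bd : forall f, L2 f -> cle (fun x => f x - u0 x) 1 -> cle (G f) Kb.
Hypothesis G_lip : forall f g e, 0 <= e -> L2 f -> L2 g ->
  cle (fun x => f x - u0 x) 1 -> cle (fun x => g x - u0 x) 1 ->
  cle (fun x => f x - g x) e -> cle (fun x => G f x - G g x) (L * e).

Variable Ts : R.
Hypothesis Ts0 : 0 < Ts.
Hypothesis TsKb : Ts * Kb <= 4^-1.
Hypothesis TsL : Ts * L <= 2^-1.

Let delta n : R := Ts / 2 ^+ n.

Let p2 n : 0 < (2 : R) ^+ n.
Proof. by rewrite exprn_gt0. Qed.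

Let delta_gt0 n : 0 < delta n.
Proof. by rewrite divr_gt0. Qed.

Let delta2 n : (2 ^ n)%:R * delta n = Ts.
Proof. by rewrite natrX mulrC mulfVK// gt_eqF. Qed.

Let deltaS n : delta n = 2 * delta n.+1.
Proof. by rewrite /delta exprS invfM; field; rewrite gt_eqF. Qed.

Let jdelta n j : (j <= 2 ^ n)%N -> j%:R * delta n <= Ts.
Proof. by move=> jn; rewrite -(delta2 n) ler_pM2r// ler_nat. Qed.

(** The meshes are dyadic so that node [j] of level [n] is node [2 * j] of level [n.+1], and
    consecutive levels can be compared node by node. *)
Fixpoint euler n j : T -> R[i] := match j with
  | 0%N => u0
  | j'.+1 => fun x => euler n j' x + (delta n)%:C * G (euler n j') x
  end.

Lemma euler_L2 n j : L2 (euler n j).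
Proof. by elim: j => //= j IH; apply: L2D => //; apply/L2Z/G_L2. Qed.

Lemma euler_ball n j : (j <= 2 ^ n)%N ->
  cle (fun x => euler n j x - u0 x) (j%:R * delta n * Kb).
Proof.
elim: j => [_|j IH jn].
  rewrite !mul0r /cnorm_le /=.
  by under [X in cnorm _ _ X]eq_fun do rewrite subrr; rewrite cnorm2_0.
have {}IH := IH (ltnW jn); have Lj := euler_L2 n j.
have b1 : cle (fun x => euler n j x - u0 x) 1.
  apply: cnorm_le_trans IH; have := jdelta (ltnW jn).
  by move: TsKb Kb0; nra.
have := cnorm_leZ (G_L2 Lj) (ltW Kb0) (ltW (delta_gt0 n)) (G_bd Lj b1).
move=> /(cnorm_leD (L2B Lj Lu0) (L2Z _ (G_L2 Lj)) IH).
rewrite (_ : j%:R * _ * _ + _ = j.+1%:R * delta n * Kb); last first.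
  by rewrite -(natr1 j); ring.
congr (cnorm_le _ _ _); apply/funext => x /=; ring.
Qed.

Lemma euler_ball4 n j : (j <= 2 ^ n)%N -> cle (fun x => euler n j x - u0 x) 4^-1.
Proof.
move=> jn; apply: cnorm_le_trans (euler_ball jn).
by apply: le_trans TsKb; rewrite ler_pM2r// jdelta.
Qed.

Lemma euler_ball1 n j : (j <= 2 ^ n)%N -> cle (fun x => euler n j x - u0 x) 1.
Proof.
move=> jn; apply: cnorm_le_trans (euler_ball4 jn).
by rewrite invf_le1// ler1n.
Qed.

Lemma euler_step n j : (j <= 2 ^ n)%N ->
  cle (fun x => euler n j.+1 x - euler n j x) (delta n * Kb).
Proof.
move=> jn; have Lj := euler_L2 n j.
have := cnorm_leZ (G_L2 Lj) (ltW Kb0) (ltW (delta_gt0 n))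
  (G_bd Lj (euler_ball1 jn)).
by congr (cnorm_le _ _ _); apply/funext => x /=; rewrite addrAC subrr add0r.
Qed.

(* The error of one step of size [delta n] against two steps of half the size is
   quadratic, so over [j] steps it is at most [j * delta n ^+ 2 * L * Kb / 2]. *)
Lemma euler_refine n j : (j <= 2 ^ n)%N ->
  cle (fun x => euler n.+1 (2 * j) x - euler n j x)
    (j%:R * delta n ^+ 2 * L * Kb / 2).
Proof.
elim: j => [_|j IH jn].
  rewrite !mul0r /cnorm_le /=.
  by under [X in cnorm _ _ X]eq_fun do rewrite subrr; rewrite cnorm2_0.
have {}IH := IH (ltnW jn).
have jn2 : (2 * j <= 2 ^ n.+1)%N by rewrite expnS leq_mul2l ltnW ?orbT.
have jn3 : ((2 * j).+1 <= 2 ^ n.+1)%N.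
  by rewrite expnS; apply: leq_trans (leq_mul (leqnn 2) jn); rewrite mulnS.
set y := euler n j in IH *; set y1 := euler n.+1 (2 * j) in IH *.
pose y2 := euler n.+1 (2 * j).+1.
have Ly : L2 y := euler_L2 _ _; have Ly1 : L2 y1 := euler_L2 _ _.
have Ly2 : L2 y2 := euler_L2 _ _.
have d0 := delta_gt0 n; have d10 := delta_gt0 n.+1; have dS := deltaS n.
have jd := jdelta (ltnW jn).
(* The quadratic bound weakened by [j%:R * delta n * L <= Ts * L <= 1 / 2]. *)
have IH' : cle (fun x => y1 x - y x) (delta n * Kb / 4).
  apply: cnorm_le_trans IH.
  rewrite [leLHS](_ : _ = (j%:R * delta n * L) * (delta n * Kb / 2)); last by ring.
  rewrite [leRHS](_ : _ = 2^-1 * (delta n * Kb / 2)); last by field.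
  rewrite ler_wpM2r//; first by rewrite divr_ge0// mulr_ge0// ltW.
  by apply: le_trans TsL; rewrite ler_pM2r.
have s1 := euler_step jn2; rewrite -/y1 -/y2 in s1.
(* Half a step moves by at most [delta n * Kb / 2], and [IH'] adds a quarter. *)
have y2y : cle (fun x => y2 x - y x) (delta n * Kb * (3 / 4)).
  have := cnorm_leD (L2B Ly2 Ly1) (L2B Ly1 Ly) s1 IH'.
  rewrite (_ : _ + _ = delta n * Kb * (3 / 4)); last by rewrite dS; field.
  by congr (cnorm_le _ _ _); apply/funext => x; ring.
have e1 : 0 <= delta n * Kb / 4 by rewrite divr_ge0// mulr_ge0// ltW.
have e2 : 0 <= delta n * Kb * (3 / 4) by rewrite mulr_ge0// mulr_ge0// ltW.
have by1 := euler_ball1 jn2; have by2 := euler_ball1 jn3.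
have by_ := euler_ball1 (ltnW jn); rewrite -/y -/y1 -/y2 in by_ by1 by2.
have l1 := G_lip e1 Ly1 Ly by1 by_ IH'.
have l2 := G_lip e2 Ly2 Ly by2 by_ y2y.
have LG1 := L2B (G_L2 Ly1) (G_L2 Ly); have LG2 := L2B (G_L2 Ly2) (G_L2 Ly).
have m1 := cnorm_leZ LG1 (mulr_ge0 (ltW L0) e1) (ltW d10) l1.
have m2 := cnorm_leZ LG2 (mulr_ge0 (ltW L0) e2) (ltW d10) l2.
have Lm1 := L2Z (delta n.+1)%:C LG1; have Lm2 := L2Z (delta n.+1)%:C LG2.
have := cnorm_leD (L2D (L2B Ly1 Ly) Lm1) Lm2
  (cnorm_leD (L2B Ly1 Ly) Lm1 IH m1) m2.
(* The factors 1/4 and 3/4 of the two half steps add up to 1, which is the increment from [j] to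
   [j.+1]. *)
rewrite (_ : _ + _ + _ = j.+1%:R * delta n ^+ 2 * L * Kb / 2); last first.
  by rewrite -(natr1 j) dS; field.
congr (cnorm_le _ _ _); apply/funext => x.
have -> : euler n.+1 (2 * j.+1) x = y2 x + (delta n.+1)%:C * G y2 x.
  by rewrite mulnS.
have -> : y2 x = y1 x + (delta n.+1)%:C * G y1 x by [].
have -> : euler n j.+1 x = y x + (delta n)%:C * G y x by [].
have -> : (delta n)%:C = (delta n.+1)%:C + (delta n.+1)%:C.
  by rewrite -rmorphD dS; congr (_%:C); ring.
ring.
Qed.

Let index n t := step_index (delta n) t.

Definition euler_at n t := euler n (index n t).

Lemma euler_index_lt n t : 0 < t < Ts -> (index n t < 2 ^ n)%N.
Proof.
move=> /andP[t0 tT]; apply: step_index_lt => //.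
by rewrite delta2 (ltW t0).
Qed.

(** The finer index at time [t] is [2 * j] or [(2 * j).+1]. Refinement costs at most
    [delta n * Kb / 4], and the second case adds half a step, 3/4 in all. *)
Lemma euler_at_refine n t : 0 < t < Ts ->
  cle (fun x => euler_at n.+1 t x - euler_at n t x) (Ts * Kb / 2 ^+ n).
Proof.
move=> tT; have jn := euler_index_lt n tT.
have j1n := euler_index_lt n.+1 tT.
have /andP[t0 _] := tT; rewrite /euler_at.
set j := index n t in jn *; set i := index n.+1 t in j1n *.
have /andP[j1 j2] := step_indexP (delta_gt0 n) (ltW t0).
have /andP[i1 i2] := step_indexP (delta_gt0 n.+1) (ltW t0).
rewrite -/(index _ _) -/j deltaS !(mulrA _ 2) in j1 j2.
rewrite -/(index _ _) -/i in i1 i2.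
have ij : (2 * j <= i)%N.
  rewrite -ltnS -(ltr_nat R) -(ltr_pM2r (delta_gt0 n.+1)) natrM.
  apply: le_lt_trans i2; by rewrite (mulrC 2%:R).
have ij2 : (i < 2 * j.+1)%N.
  rewrite -(ltr_nat R) -(ltr_pM2r (delta_gt0 n.+1)) natrM.
  by apply: le_lt_trans i1 _; rewrite (mulrC 2%:R).
have d0 := delta_gt0 n.
have e1 : cle (fun x => euler n.+1 (2 * j) x - euler n j x) (delta n * Kb / 4).
  apply: cnorm_le_trans (euler_refine (ltnW jn)).
  rewrite [leLHS](_ : _ = (j%:R * delta n * L) * (delta n * Kb / 2)); last by ring.
  rewrite [leRHS](_ : _ = 2^-1 * (delta n * Kb / 2)); last by field.
  rewrite ler_wpM2r//; first by rewrite divr_ge0// mulr_ge0// ltW.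
  by apply: le_trans TsL; rewrite ler_pM2r// jdelta// ltnW.
have dE : Ts * Kb / 2 ^+ n = delta n * Kb by rewrite /delta mulrAC.
rewrite dE; have [->|i2j] : i = (2 * j)%N \/ i = (2 * j).+1.
  by move: ij; rewrite leq_eqVlt => /orP[/eqP <-|h]; [left|right;
    apply/eqP; rewrite eqn_leq h andbT -ltnS (leq_trans ij2)// mulnS].
  apply: cnorm_le_trans e1; move: (mulr_gt0 d0 Kb0); lra.
have jn2 : (2 * j <= 2 ^ n.+1)%N by rewrite expnS leq_mul2l ltnW ?orbT.
have := cnorm_leD (L2B (euler_L2 _ _) (euler_L2 _ _))
  (L2B (euler_L2 _ _) (euler_L2 _ _)) (euler_step jn2) e1.
move=> H; apply: (cnorm_le_trans (r := delta n.+1 * Kb + delta n * Kb / 4)).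
  by rewrite (deltaS n); move: (mulr_gt0 (delta_gt0 n.+1) Kb0); lra.
by rewrite i2j; move: H; congr (cnorm_le _ _ _); apply/funext => x; ring.
Qed.

Lemma euler_limit : exists u : R -> T -> R[i], forall t, 0 < t < Ts ->
  L2 (u t) /\ forall n,
  cle (fun x => euler_at n t x - u t x) (2 * (Ts * Kb) / 2 ^+ n).
Proof.
have /choice[u uP] : forall t, exists v, 0 < t < Ts -> L2 v /\ forall n,
    cle (fun x => euler_at n t x - v x) (2 * (Ts * Kb) / 2 ^+ n).
  move=> t; have [tT|_] := boolP (0 < t < Ts); last by exists u0.
  have TK : 0 <= Ts * Kb by rewrite mulr_ge0// ltW.
  have [v Lv vP] := L2_complete TK (fun n => euler_L2 n (index n t))
    (fun n => euler_at_refine n tT).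
  by exists v.
by exists u.
Qed.

Lemma euler_sum n k x :
  \sum_(j < k) (delta n)%:C * G (euler n j) x = euler n k x - u0 x.
Proof.
elim: k => [|k IH]; first by rewrite big_ord0 subrr.
by rewrite big_ord_recr /= IH addrAC.
Qed.

Lemma euler_solution : exists2 u, Linfty_L2 mu Ts u &
  forall t, 0 < t < Ts ->
    bochner_integral mu `]0, t[ (fun tau => G (u tau)) (fun x => u t x - u0 x).
Proof.
have [u uP] := euler_limit.
have Lu t : 0 < t < Ts -> L2 (u t) by move=> /uP[].
have uE t n : 0 < t < Ts ->
    cle (fun x => euler_at n t x - u t x) (2 * (Ts * Kb) / 2 ^+ n).
  by move=> /uP[].
have LE n t : L2 (euler_at n t) by exact: euler_L2.
have bE n t : 0 < t < Ts -> cle (fun x => euler_at n t x - u0 x) 4^-1.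
  by move=> tT; apply/euler_ball4/ltnW/euler_index_lt.
have bE1 n t : 0 < t < Ts -> cle (fun x => euler_at n t x - u0 x) 1.
  by move=> tT; apply/euler_ball1/ltnW/euler_index_lt.
(* The scheme is within 1/4 of [u0], and [u t] is within [2 * (Ts * Kb) <= 1 / 2] of its level 0, so
   [u t] stays in the ball where [G] is controlled. *)
have bu t : 0 < t < Ts -> cle (fun x => u t x - u0 x) 1.
  move=> tT; have := cnorm_leB (L2B (LE 0%N t) Lu0) (L2B (LE 0%N t) (Lu t tT))
    (bE 0%N t tT) (uE t 0%N tT).
  rewrite expr0 divr1 => H; apply: cnorm_le_trans (_ : cle _ (4^-1 + 2 * (Ts * Kb))).
    by move: TsKb; lra.
  by move: H; congr (cnorm_le _ _ _); apply/funext => x; ring.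
have TK : 0 < Ts * Kb by rewrite mulr_gt0.
have C0 n : 0 <= 2 * (Ts * Kb) / 2 ^+ n.
  by rewrite divr_ge0 ?(ltW (p2 n))// mulr_ge0// ltW.
pose sU n := step_simple (delta n) (2 ^ n) (euler_L2 n).
(* Same steps as [sU], with the slopes as values: these approximate [G (u tau)] by the Lipschitz
   bound, and their time integral is explicit. *)
pose sV n := step_simple (delta n) (2 ^ n) (fun j => G_L2 (euler_L2 n j)).
have tE n t : 0 < t < Ts -> 0 <= t < (2 ^ n)%:R * delta n.
  by move=> /andP[t0 tT]; rewrite delta2 (ltW t0).
have sUE n t : 0 < t < Ts -> simple_fun (sU n) t = euler_at n t.
  by move=> tT; rewrite /sU step_simple_fun//; exact: tE.
have sVE n t : 0 < t < Ts -> simple_fun (sV n) t = G (euler_at n t).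
  by move=> tT; rewrite /sV step_simple_fun//; exact: tE.
have dU n t : 0 < t < Ts ->
    (L2dist mu (simple_fun (sU n) t) (u t) <= (2 * (Ts * Kb) / 2 ^+ n)%:E)%E.
  by move=> tT; rewrite sUE//; exact: uE.
pose CV := L * (2 * (Ts * Kb)).
have CV0 : 0 <= CV by rewrite mulr_ge0 ?mulr_ge0 ?ltW.
have dV n t : 0 < t < Ts ->
    (L2dist mu (simple_fun (sV n) t) (G (u t)) <= (CV / 2 ^+ n)%:E)%E.
  move=> tT; rewrite sVE//.
  have := G_lip (C0 n) (LE n t) (Lu t tT) (bE1 n t tT) (bu t tT) (uE t n tT).
  by rewrite /CV mulrA -mulrA mulrA.
have sub t s : 0 < t < Ts -> `]0, t[%classic s -> 0 < s < Ts.
  by move=> /andP[_ tT] /=; rewrite in_itv /= => /andP[-> /lt_trans]; exact.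
have approxV t : 0 < t < Ts ->
    simple_approx `]0, t[ (fun tau => G (u tau)) sV.
  move=> tT; apply: aeW => s st; apply: (cvge0_geometric (C := CV)).
    by move=> n; exact: cnorm_ge0.
  by move=> n; apply: dV; exact: sub st.
exists u.
  split; first split.
  - by apply: aeW => t; rewrite /= in_itv /=; exact: Lu.
  - exists sU; apply: aeW => t; rewrite /= in_itv /= => tT.
    apply: (cvge0_geometric (C := 2 * (Ts * Kb))).
      by move=> n; exact: cnorm_ge0.
    by move=> n; exact: dU.
  have [r r0 u0r] := L2_fin Lu0; exists (1 + r); apply: aeW => t.
  rewrite /= in_itv /= => tT.
  have := cnorm_leD (L2B (Lu t tT) Lu0) Lu0 (bu t tT) (_ : cle u0 r).
  rewrite {1}/cnorm_le u0r lexx => /(_ isT).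
  by congr (cnorm_le _ _ _); apply/funext => x; rewrite subrK.
move=> t tT; have /andP[t0 _] := tT; split.
- split; last by exists sV; exact: approxV.
  by apply: aeW => s st; apply/G_L2/Lu; exact: sub st.
- exact: L2B (Lu t tT) Lu0.
exists sV; split; first exact: approxV.
  apply: (cvge0_geometric (C := CV * t)) => n.
    by apply: integral_ge0 => s _; exact: cnorm_ge0.
  have CVn : 0 <= CV / 2 ^+ n by rewrite divr_ge0// ltW.
  apply: le_trans (integral_le_cst (C := CV / 2 ^+ n) _ CVn _) _.
  - exact: measurable_itv.
  - by move=> s st; rewrite cnorm_ge0 dV//; exact: sub st.
  rewrite lebesgue_measure_itv /= lte_fin t0 -EFinB subr0 -EFinM lee_fin.
  by rewrite mulrAC.
(* The integral of [sV n] is the current node minus [u0] plus a partial step. The node is within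
   [2 * (Ts * Kb) / 2 ^+ n] of [u t] and the partial step has norm at most [delta n * Kb], whence
   the 3. *)
apply: (cvge0_geometric (C := 3 * (Ts * Kb))) => n; first exact: cnorm_ge0.
have kn := euler_index_lt n tT.
have /andP[i1 i2] := step_indexP (delta_gt0 n) (ltW t0).
have Gk := G_bd (LE n t) (bE1 n t tT).
set k := step_index _ _ in i1 i2.
have r0 : 0 <= t - k%:R * delta n by rewrite subr_ge0.
have r1 : t - k%:R * delta n <= delta n.
  by move: (ltW i2); rewrite lerBlDl -natr1 mulrDl mul1r.
have := cnorm_leD (L2B (LE n t) (Lu t tT)) (L2Z _ (G_L2 (LE n t))) (uE t n tT)
  (cnorm_leZ (G_L2 (LE n t)) (ltW Kb0) r0 Gk).
move=> H; have {}H := cnorm_le_trans (s := 3 * (Ts * Kb) / 2 ^+ n) _ H.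
rewrite /L2dist.
rewrite (_ : (fun x => _) = (fun x => euler_at n t x - u t x +
  (t - k%:R * delta n)%:C * G (euler_at n t) x)).
  apply: H.
  rewrite [leRHS](_ : _ = 2 * (Ts * Kb) / 2 ^+ n + delta n * Kb); last first.
    by rewrite /delta; field; rewrite gt_eqF.
  by rewrite lerD2l ler_wpM2r// ltW.
apply/funext => x.
rewrite /sV step_simple_integral//; last exact: tE.
by rewrite euler_sum -/k /euler_at -/(index _ _); ring.
Qed.

End euler_scheme.

(** * The choice of the existence time *)

Section local_solution.
Context d (T : measurableType d) (R : realType).
Variable mu : {measure set T -> \bar R}.
Local Notation L2 := (inLp mu 2%:E).

Lemma local_mild_solution (B : (T -> R[i]) -> T -> R[i]) (p C : R)
    (u0 : T -> R[i]) :
  linear_on_L2 mu B -> (forall f, L2 f -> cmeasurable (B f)) ->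
  1 < p -> 0 <= C ->
  (forall f, L2 f -> (energy mu f <= 1)%E ->
    (\int[mu]_x (normc (B f x) `^ (2 * p))%:E <= C%:E)%E) ->
  L2 u0 -> exists2 Ts : R, 0 < Ts &
    exists2 u, Linfty_L2 mu Ts u & mild_solution mu B p u0 Ts u.
Proof.
move=> B_lin B_meas p1 C0 B_unit Lu0.
have [r0 r0_ge0 u0r] := L2_fin Lu0.
(* Bounds the norm on the unit ball around [u0], and is positive even when [r0] is 0. *)
pose r := r0 + 1; have r_gt0 : 0 < r by rewrite ltr_wpDl.
have ball_r f : L2 f -> cnorm_le mu (fun x => f x - u0 x) 1 ->
    (cnorm mu 2%:E f <= r%:E)%E.
  move=> Lf f1; have u0r' : cnorm_le mu u0 r0 by rewrite /cnorm_le u0r.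
  have := cnorm_leD (L2B Lf Lu0) Lu0 f1 u0r'.
  rewrite /r addrC; congr (cnorm_le _ _ _).
  by apply/funext => x; rewrite subrK.
(* The summand 1 in [Kb] and in [L] keeps both positive when [C] is 0. *)
pose Kb := Num.sqrt (C * r `^ (2 * p)) + 1.
pose L := p * Num.sqrt (C * (2 * r `^ (2 * p) + 1)) + 1.
have p0 : 0 < p := lt_trans ltr01 p1.
have Kb_gt0 : 0 < Kb by rewrite ltr_wpDl ?sqrtr_ge0.
have L_gt0 : 0 < L by rewrite ltr_wpDl ?mulr_ge0 ?sqrtr_ge0 ?ltW.
have G_L2 := operator_power_L2 B_lin B_meas C0 B_unit.
have G_bd f : L2 f -> cnorm_le mu (fun x => f x - u0 x) 1 ->
    cnorm_le mu (operator_power B p f) Kb.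
  move=> Lf /(ball_r f Lf) fr.
  apply: cnorm_le_trans (operator_power_bound B_lin B_meas C0 B_unit r_gt0 Lf fr).
  by rewrite lerDl.
have G_lip f g e : 0 <= e -> L2 f -> L2 g ->
    cnorm_le mu (fun x => f x - u0 x) 1 ->
    cnorm_le mu (fun x => g x - u0 x) 1 ->
    cnorm_le mu (fun x => f x - g x) e ->
    cnorm_le mu (fun x => operator_power B p f x - operator_power B p g x)
      (L * e).
  move=> e0 Lf Lg /(ball_r f Lf) fr /(ball_r g Lg) gr fg.
  apply: cnorm_le_trans
    (operator_power_lip B_lin B_meas p1 C0 B_unit r_gt0 e0 Lf Lg fr gr fg).
  by rewrite ler_wpM2r// lerDl.
(* The first bound keeps the scheme and its limit in the unit ball around [u0]; the second keeps the
   refinement errors within [delta n * Kb / 4]. *)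
pose Ts := Num.min (4^-1 / Kb) (2^-1 / L).
have Ts_gt0 : 0 < Ts by rewrite lt_min !divr_gt0.
have TsKb : Ts * Kb <= 4^-1 by rewrite -ler_pdivlMr// ge_min lexx.
have TsL : Ts * L <= 2^-1 by rewrite -ler_pdivlMr// ge_min lexx orbT.
have [u u_Linfty uP] := euler_solution Lu0 Kb_gt0 L_gt0 G_L2 G_bd G_lip
  Ts_gt0 TsKb TsL.
exists Ts => //; exists u => //; apply: aeW => s; rewrite /= in_itv /= => sT.
exists (fun x => u s x - u0 x); first exact: uP.
by apply: aeW => x _; rewrite addrC subrK.
Qed.

End local_solution.

(** * The transform and the weak norm of the symbol *)

Section ka_measure_sigma_finite.
Variables (R : realType) (N : nat).
Variables (Rt : {fset 'rV[R]_N}) (k : 'rV[R]_N -> R) (a : R).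

(** The weight may be unbounded, so sets of finite Lebesgue measure are cut down to its sublevel
    sets; these exhaust the space because the weight is a real number at every point. *)
Lemma ka_measure_sigma_finite : sigma_finite setT (ka_measure Rt k a).
Proof.
have /sigma_finiteP[D [DT ndD mD]] := sigma_finiteT (lebesgue_rV R N).
have mw := measurable_weight Rt k a.
exists (fun n => D n `&` [set x | weight Rt k a x <= n%:R]).
  apply/esym/seteqP; split=> // x _.
  have [i _ Di] : (\bigcup_i D i) x by rewrite -DT.
  exists (maxn i (Num.bound (weight Rt k a x))) => //; split.
    by move: Di; apply/subsetPset/ndD; exact: leq_maxl.
  rewrite /=; apply: (le_trans (ltW (archi_boundP (weight_ge0 _ _ _ _)))).
  by rewrite ler_nat leq_maxr.
move=> n; have [mDn Dn] := mD n.
have mA : measurable (D n `&` [set x | weight Rt k a x <= n%:R]).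
  by apply: measurableI => //; exact: measurable_le_set.
split=> //; rewrite /ka_measure /=.
apply: (@le_lt_trans _ _ (\int[lebesgue_rV R N]_(x in
    D n `&` [set x | (weight Rt k a x <= n%:R)%R]) (cst n%:R%:E) x)%E).
  apply: ge0_le_integral => //.
  - by move=> x _; rewrite lee_fin weight_ge0.
  - by apply/measurable_EFinP; exact: measurable_funTS.
  - by move=> x [_ wn]; rewrite lee_fin.
rewrite integral_cst//.
apply: (@le_lt_trans _ _ (n%:R%:E * lebesgue_rV R N (D n))%E).
  by rewrite lee_wpmul2l ?lee_fin// le_measure ?inE//; exact: subIsetl.
by rewrite lte_mul_pinfty// ?lee_fin// ge0_fin_numE.
Qed.

HB.instance Definition _ := Measure_isSigmaFinite.Build _ _ _
  (ka_measure Rt k a) ka_measure_sigma_finite.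

End ka_measure_sigma_finite.

Section weak_symbol.
Variables (R : realType) (N : nat).
Variables (Rt : {fset 'rV[R]_N}) (k : 'rV[R]_N -> R) (a : R).
Local Notation mu := (ka_measure Rt k a).

(** The exponent [theta] of the weak norm is the inverse of [2 * p / (p - 1)], and [W] is the weak
    norm itself. *)
Lemma weak_symbol_level (p : R) (h : 'rV[R]_N -> R[i]) : 1 < p ->
  (weak_symbol_norm Rt k a p h < +oo)%E -> exists2 W : R, 0 <= W &
  forall s, 0 < s -> (mu [set x | (s <= normc (h x))%R] <=
    ((W / s) `^ (2 * p / (p - 1)))%:E)%E.
Proof.
move=> p1 hoo; have p0 : 0 < p := lt_trans ltr01 p1.
set theta : R := 1 / 2 - 1 / (2 * p).
have p10 : 0 < p - 1 by rewrite subr_gt0.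
have thE : theta = (p - 1) / (2 * p) by rewrite /theta; field; rewrite gt_eqF.
have th0 : 0 < theta by rewrite thE divr_gt0// mulr_gt0.
set S := weak_symbol_norm Rt k a p h in hoo.
have Sub s : 0 < s ->
    (s%:E * mu [set x | (s <= normc (h x))%R] `^ theta <= S)%E.
  by move=> s0; apply: ereal_sup_ubound; exists s.
have S0 : (0 <= S)%E.
  by apply: le_trans (Sub 1 ltr01); rewrite mul1e poweR_ge0.
have Sfin : S \is a fin_num by rewrite ge0_fin_numE.
exists (fine S); first exact: fine_ge0.
move=> s s0; pose X := ka_measure Rt k a [set x | (s <= normc (h x))%R].
have X0 : (0 <= X)%E by exact: measure_ge0.
have := Sub s s0; rewrite -/X -{1}(fineK Sfin).
(* A level set of infinite measure would make the supremum infinite, as [theta] is positive. *)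
case: X X0 => [m|_|] //=; last first.
  by rewrite (gt_eqF th0) gt0_muley ?lte_fin.
rewrite !lee_fin => m0 sm; rewrite -lee_fin.
have {}sm : m `^ theta <= fine S / s by rewrite ler_pdivlMr// mulrC.
rewrite lee_fin (_ : 2 * p / (p - 1) = theta^-1); last first.
  by rewrite thE invf_div.
rewrite -[leLHS](powRr1 m0) -(mulfV (lt0r_neq0 th0)) powRrM.
by rewrite ge0_ler_powR ?nnegrE ?powR_ge0 ?invr_ge0 ?(ltW th0) ?divr_ge0
  ?(ltW s0) ?fine_ge0.
Qed.

End weak_symbol.

Lemma normc_cis (R : realType) (t : R) : normc (cis t) = 1.
Proof. by rewrite /= cos2Dsin2 sqrtr1. Qed.

Lemma conjc_cisK (R : realType) (t : R) : cis t * (cis t)^* = 1.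
Proof.
apply/eqP; rewrite eq_complex /= mulrN opprK -!expr2 cos2Dsin2 eqxx /=.
by apply/eqP; ring.
Qed.

Section ka_unitary.
Context d (T : measurableType d) (R : realType).
Variable mu : {measure set T -> \bar R}.
Implicit Types f g : T -> R[i].
Local Notation L2 := (inLp mu 2%:E).

Lemma unitary_phase (E : (T -> R[i]) -> T -> R[i]) (t : R) :
  unitary_on_L2 mu E -> let U f x := cis t * E f x in
  [/\ forall f, L2 f -> L2 (U f), linear_on_L2 mu U,
      forall f, L2 f -> energy mu (U f) = energy mu f
    & forall g, L2 g -> exists2 f, L2 f & U f = g %[ae mu]].
Proof.
move=> [E_L2 E_lin E_iso E_surj] U; split.
- by move=> f Lf; apply/L2Z/E_L2.
- move=> z f g Lf Lg; apply: filterS (E_lin z f g Lf Lg) => x /(_ I) Ex _.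
  by rewrite /U Ex; ring.
- move=> f Lf; have [mEf _] := E_L2 f Lf.
  by rewrite /U energyZ// normc_cis expr1n mul1e -!cnorm2_sqr E_iso.
- move=> g Lg; have [f Lf Ef] := E_surj _ (L2Z (cis t)^* Lg).
  exists f => //; apply: filterS Ef => x /(_ I) Ex _.
  by rewrite /U Ex mulrA conjc_cisK mul1r.
Qed.

End ka_unitary.

Theorem theorem3p1 (R : realType) (N : nat) (N_ge1 : (1 <= N)%N)
    (Rt Rp : {fset 'rV[R]_N}) (k : 'rV[R]_N -> R) (a : R)
    (Rt_root : root_system Rt) (Rp_pos : positive_subsystem Rt Rp)
    (k_mult : multiplicity Rt k) (a_gt0 : 0 < a)
    (dim_gt0 : 0 < a + 2 * kindex Rt k + N%:R - 2)
    (F : ('rV[R]_N -> R[i]) -> ('rV[R]_N -> R[i]))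
    (F_fourier : ka_fourier Rt Rp k a F)
    (c : R[i]) (K : 'rV[R]_N -> 'rV[R]_N -> R[i])
    (K_bounded : bounded_ka_kernel Rt k a F c K)
    (p : R) (p_gt1 : 1 < p)
    (B : ('rV[R]_N -> R[i]) -> ('rV[R]_N -> R[i])) (h : 'rV[R]_N -> R[i])
    (B_mult : ka_multiplier Rt k a F c K B h)
    (h_weak : (weak_symbol_norm Rt k a p h < +oo)%E)
    (u0 : 'rV[R]_N -> R[i]) (u0_L2 : inLp (ka_measure Rt k a) 2%:E u0) :
  exists2 Ts : R, 0 < Ts &
    exists2 u : R -> 'rV[R]_N -> R[i],
      Linfty_L2 (ka_measure Rt k a) Ts u &
      mild_solution (ka_measure Rt k a) B p u0 Ts u.
Proof.
pose L2 := inLp (ka_measure Rt k a) 2%:E.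
have [E [E_unitary _] FE] := F_fourier.
have [mK K_sym [M KM] F_ker] := K_bounded.
have [mh B_lin B_meas B_inv] := B_mult.
set t := pi / 2 * _ in FE.
have [U_L2 U_lin U_iso U_surj] := unitary_phase t E_unitary.
(* [F f] is prescribed only up to a null set, so its measurability is not at hand; [U f] is a
   measurable representative of it for [f] in L^2. *)
set U := (fun f x => cis t * E f x) in U_L2 U_lin U_iso U_surj.
have FU f : L2 f -> F f = U f %[ae ka_measure Rt k a] by exact: FE.
have U_ker f : inLp (ka_measure Rt k a) 1%:E f -> L2 f ->
    U f = (fun xi => c * cintegral (ka_measure Rt k a) (fun x => K xi x * f x))
    %[ae ka_measure Rt k a].
  move=> L1f L2f; move: (FU f L2f) (F_ker f L1f L2f).
  by apply: filterS2 => x /(_ I) -> /(_ I) ->.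
have [W W0 h_level] := weak_symbol_level p_gt1 h_weak.
have [C C0 bound] := multiplier_unit_bound mK KM U_L2 U_lin U_iso U_surj U_ker
  mh W0 p_gt1 h_level.
have B_unit f : L2 f ->
    (energy (ka_measure Rt k a) f <= 1)%E ->
    (\int[ka_measure Rt k a]_x (normc (B f x) `^ (2 * p))%:E <= C%:E)%E.
  move=> Lf f1; apply: (bound (U f)); [exact: U_L2|by rewrite U_iso|exact: B_meas|].
  have [g1 [g2 [v [Lg1 Lg2 gE [Lv Fv] wE]]]] := B_inv f Lf.
  exists g1, g2, v; split=> //.
    by move: (FU f Lf) gE; apply: filterS2 => x /(_ I) <- /(_ I) <-.
  split=> //; move: (FU v Lv) Fv.
  by apply: filterS2 => x Fx Fvx _; rewrite -[LHS](Fx I) (Fvx I).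
exact: local_mild_solution B_lin B_meas p_gt1 C0 B_unit u0_L2.
Qed.
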